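(* Consider any one of FS, LAR, or lasso run for $k$ steps. Fix any model $M\in\mathcal M$, $\mu\in\mathbb R$, and let $v=X_A(X_A^TX_A)^{-1}e_j\big/\sqrt{e_j^T(X_A^TX_A)^{-1}e_j}$ for a fixed subset $A\subseteq\{1,\dots,d\}$ and index $j$ (so that $v^Ty$ is a normalized coefficient from projecting $y$ onto a subset of the variables in $X$). Let $Y\in\mathbb R^n$ be drawn from the model $Y_i=\theta_i+\epsilon_i$, $i=1,\dots,n$, with $X$ fixed, $\theta\in\mathbb R^n$, and $\epsilon_1,\dots,\epsilon_n$ i.i.d. with mean zero, and let $\Omega_n=\big(\frac1nX^TX,\frac1{\sqrt n}X^TY\big)$. Then there is a function $g$ such that $$v^T\theta=g(\mathbb E(\Omega_n)).$$ Thus, if the errors $\epsilon_i$ are i.i.d. $N(0,\sigma^2)$, the conditional pivotal property of the TG statistic ($\mathbb P_{v^T\theta=\mu}(T(X,Y;M,v,\mu)\le t\mid\hat M(X,Y)=M)=t$) can be reexpressed as $$\mathbb P_{g(\mathbb E(\Omega_n))=\mu}\Big(\psi_M(\Omega_n)\le t\ \Big|\ \hat M(X,Y)=M\Big)=t\qquad\text{for all }t\in[0,1],$$ where $\psi_M$ is the function with $T(X,y;M,v,\mu)=\psi_M\big(\frac1nX^TX,\frac1{\sqrt n}X^Ty\big)$.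
   Context: **Setup.** $X\in\mathbb R^{n\times d}$ has columns $X_1,\dots,X_d$; $y\in\mathbb R^n$; $k\ge 1$ is a fixed number of steps. For an ordered list $A$ of distinct indices, $X_A$ is the matrix with these columns and $P_A^\perp=I-X_A(X_A^TX_A)^{-1}X_A^T$ ($=I$ if $A=\emptyset$). All inverses and reciprocals written below are assumed to exist. Inequalities between vectors are componentwise. $\mathbb P_{f(\theta)=\mu}$ denotes probability under an arbitrary mean vector $\theta$ with $f(\theta)=\mu$. **Procedures and selected models.** Each procedure starts from $A_0=\emptyset$ and produces active lists $A_1,\dots,A_k$ and sign vectors $s_\ell\in\{-1,1\}^{|A_\ell|}$, which are the signs of the least squares coefficients on the active variables: $\mathrm{diag}(s_\ell)(X_{A_\ell}^TX_{A_\ell})^{-1}X_{A_\ell}^Ty\ge 0$, $\ell=1,\dots,k$. *FS (forward stepwise).* $A_\ell=(A_{\ell-1},j_\ell)$ where $j_\ell\notin A_{\ell-1}$ satisfies, with $P=P^\perp_{A_{\ell-1}}$ and $s_{\ell,\ell}$ the last entry of $s_\ell$, $s_{\ell,\ell}\,X_{j_\ell}^TPy/\|PX_{j_\ell}\|_2^2\ \ge\ \pm X_j^TPy/\|PX_j\|_2^2$ for all $j\notin A_\ell$. The model is $M=\{(A_\ell,s_\ell):\ell=1,\dots,k\}$. *LAR (least angle regression).* One also tracks entry signs $\sigma_{\ell}\in\{-1,1\}^{|A_\ell|}$ and knots $\lambda_0=+\infty\ge\lambda_1\ge\cdots\ge\lambda_k\ge0$. At step $\ell$, with $A=A_{\ell-1}$,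 $\sigma=\sigma_{\ell-1}$ (sign vector), put, for $j\notin A$ and $s\in\{-1,1\}$, $c_\ell(j,s)=P_A^\perp X_j/\big(s-X_j^TX_A(X_A^TX_A)^{-1}\sigma\big)$. The eligible pairs are those $(j,s)$ with $c_\ell(j,s)^Ty\le\lambda_{\ell-1}$ (ineligible ones satisfy $\ge$); the pair $(j_\ell,s'_\ell)$ maximizing $c_\ell(j,s)^Ty$ over eligible pairs enters, $\lambda_\ell$ is this maximum, $A_\ell=(A,j_\ell)$, $\sigma_\ell=(\sigma,s'_\ell)$. The extra information $I_\ell$ is the set of eligible pairs together with the entering pair. The model is $M=\{(A_\ell,s_\ell,I_\ell):\ell=1,\dots,k\}$. *Lasso.* As LAR, but at step $\ell$ there are also crossing candidates $j\in A=A_{\ell-1}$ with $d_\ell(j)=X_A(X_A^TX_A)^{-1}e_j/\big(e_j^T(X_A^TX_A)^{-1}\sigma\big)$ ($e_j$ the basis vector at the position of $j$ in $A$), eligible if $d_\ell(j)^Ty\le\lambda_{\ell-1}$ (ineligible ones satisfy $\ge$). A variable that joined at step $\ell-1$ is not a crossing candidate at step $\ell$, and a variable that left at step $\ell-1$ is not a joining candidate at step $\ell$ with the sign it had. $\lambda_\ell\ge 0$ is the maximum of all eligible $c_\ell(j,s)^Ty$ and $d_\ell(j)^Ty$; if attained by a joining pair it is appended, if attained by a crossing variable that variable and its sign are removed. $I_\ell$ is the set of eligible joining pairs, the set of eligible crossing variables, and the event (join/leave) that occurs. The model is $M=\{(A_\ell,s_\ell,I_\ell)\}_{\ell=1}^k$.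 **Selection event.** $\mathcal M$ is the finite set of achievable models. For fixed $M$ all the conditions above are linear inequalities in $y$; $\hat M(X,y)=M$ means that all of these (weak) inequalities hold. $Q_M(X)$ is the matrix whose rows give these inequalities (identically zero rows omitted; rows matter only up to positive scaling), so $\hat M(X,y)=M\iff Q_M(X)y\ge0$. Conditional probabilities are considered when the conditioning event has positive probability. **TG (truncated Gaussian) statistic.** Fix known $\sigma>0$ and let $\Phi$ be the standard normal CDF. For $v\in\mathbb R^n\setminus\{0\}$, $\mu\in\mathbb R$ and $y$ with $\hat M(X,y)=M$, put $w=Q_M(X)v/\|v\|_2^2$, $$a=v^Ty-\min_{i:w_i>0}\frac{(Q_M(X)y)_i}{w_i},\qquad b=v^Ty-\max_{i:w_i<0}\frac{(Q_M(X)y)_i}{w_i}$$ ($\min\emptyset=+\infty$, $\max\emptyset=-\infty$), and $$T(X,y;M,v,\mu)=\frac{\Phi\big(\frac{b-\mu}{\sigma\|v\|_2}\big)-\Phi\big(\frac{v^Ty-\mu}{\sigma\|v\|_2}\big)}{\Phi\big(\frac{b-\mu}{\sigma\|v\|_2}\big)-\Phi\big(\frac{a-\mu}{\sigma\|v\|_2}\big)}.$$ For $v$ of the form in the claim, $T(X,y;M,v,\mu)$ depends on $(X,y)$ only through $(\frac1nX^TX,\frac1{\sqrt n}X^Ty)$, and $\psi_M$ denotes the corresponding function. *)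

(* Defs.v *)
From HB Require Import structures.
From mathcomp Require Import all_boot all_order all_algebra.
From mathcomp Require Import all_classical all_reals all_analysis.

Set Implicit Arguments.
Unset Strict Implicit.
Unset Printing Implicit Defensive.

Import Order.TTheory GRing.Theory Num.Theory.
Local Open Scope classical_set_scope.
Local Open Scope ring_scope.

(* Signs are booleans: [b] stands for [(-1) ^+ b], so [false] is +1 and [true]
   is -1.  Active lists are sequences of distinct indices, in order of entry. *)

Section linear_algebra.
Context {R : realType} {n d : nat}.
Implicit Types (X : 'M[R]_(n, d)) (y : 'cV[R]_n) (A : seq 'I_d).

Definition dotp m (u v : 'cV[R]_m) : R := (u^T *m v) 0 0.

Definition l2norm m (u : 'cV[R]_m) : R := Num.sqrt (dotp u u).

Definition cols X A : 'M[R]_(n, size A) := colsub (tnth (in_tuple A)) X.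

Definition gram X A : 'M[R]_(size A) := (cols X A)^T *m cols X A.

Definition lscoef X A : 'M[R]_(size A, n) := invmx (gram X A) *m (cols X A)^T.

Definition Pperp X A : 'M[R]_n := 1%:M - cols X A *m lscoef X A.

(* Basis vector at the position of [j] in [A] (for [j \in A], [A] duplicate
   free). *)
Definition basis_at A (j : 'I_d) : 'cV[R]_(size A) :=
  \col_(i < size A) (tnth (in_tuple A) i == j)%:R.

Definition signvec (m : nat) (s : seq bool) : 'cV[R]_m :=
  \col_(i < m) (-1) ^+ nth false s i.

End linear_algebra.

Variant procedure := FS | LAR | Lasso.

(* [inl (j, s)]: variable [j] joins with sign [s];
   [inr j]: the coefficient of the active variable [j] crosses zero. *)
Definition candidate (d : nat) : finType := ('I_d * bool + 'I_d)%type.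

(* (A_l, s_l) *)
Definition fs_step (d : nat) : eqType := (seq 'I_d * seq bool)%type.

(* (A_l, s_l, (eligible candidates, event that occurs)); the sum type encodes
   the pair (eligible joining pairs, eligible crossing variables). *)
Definition path_step (d : nat) : eqType :=
  (seq 'I_d * seq bool * ({set candidate d} * candidate d))%type.

Definition step (p : procedure) (d : nat) : eqType :=
  match p with FS => fs_step d | LAR | Lasso => path_step d end.

Definition model (p : procedure) (d k : nat) := k.-tuple (step p d).

Section signs.
Context {R : realType} {n d : nat}.
Variable X : 'M[R]_(n, d).

Definition sign_ok (y : 'cV[R]_n) (A : seq 'I_d) (s : seq bool) : Prop :=
  size s = size A /\
  forall i : 'I_(size A),
    0 <= (-1) ^+ nth false s i * (lscoef X A *m y) i 0.

Definition sign_rows (A : seq 'I_d) (s : seq bool) : seq 'rV[R]_n :=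
  [seq (-1) ^+ nth false s i *: row i (lscoef X A) | i : 'I_(size A)].

End signs.

Section forward_stepwise.
Context {R : realType} {n d : nat}.
Variable X : 'M[R]_(n, d).

(* The pairs (A_(l-1), (A_l, s_l)), l = 1, ..., k. *)
Definition fs_ctx (M : seq (fs_step d)) : seq (seq 'I_d * fs_step d) :=
  zip ([::] :: unzip1 M) M.

Definition fs_vec (A : seq 'I_d) (j : 'I_d) : 'rV[R]_n :=
  (l2norm (Pperp X A *m col j X) ^- 2) *: ((col j X)^T *m Pperp X A).

Definition fs_ok (y : 'cV[R]_n) (x : seq 'I_d * fs_step d) : Prop :=
  let: (A, (A', s)) := x in
  exists j, [/\ j \notin A, A' = rcons A j, sign_ok X y A' s &
    forall (i : 'I_d) (b : bool), i \notin A' ->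
      (-1) ^+ b * (fs_vec A i *m y) 0 0 <=
      (-1) ^+ last false s * (fs_vec A j *m y) 0 0].

(* Triples (j, i, b): [j] is the variable entering, [i] one left outside. *)
Definition fs_rows (x : seq 'I_d * fs_step d) : seq 'rV[R]_n :=
  let: (A, (A', s)) := x in
  sign_rows X A' s ++
  [seq (-1) ^+ last false s *: fs_vec A t.1.1 - (-1) ^+ t.2 *: fs_vec A t.1.2
     | t : 'I_d * 'I_d * bool in [pred t : 'I_d * 'I_d * bool |
             [&& t.1.1 \in A', t.1.1 \notin A & t.1.2 \notin A']]].

Definition fs_regular (x : seq 'I_d * fs_step d) : Prop :=
  let: (A, (A', _)) := x in
  gram X A' \in unitmx /\
  forall j, j \notin A -> l2norm (Pperp X A *m col j X) ^+ 2 != 0.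

End forward_stepwise.

Section path_procedures.
Context {R : realType} {n d : nat}.
Variables (lasso : bool) (X : 'M[R]_(n, d)).

(* A state lists the active variables with their entry signs sigma. *)
Definition state := seq ('I_d * bool).
Implicit Types (st : state) (c : candidate d).

Definition update st c : state :=
  match c with
  | inl js => rcons st js
  | inr j => [seq q <- st | q.1 != j]
  end.

(* What the event [c] occurring in state [st] forbids at the next step: the
   crossing of a variable that has just joined, or the joining of a variable
   that has just left with the sign it had. *)
Definition banned st c : candidate d :=
  match c with
  | inl (j, _) => inr j
  | inr j => inl (j, nth false (unzip2 st) (index j (unzip1 st)))
  end.

(* (state before the step, state and event of the preceding step if any) *)
Definition ctx := (state * option (state * candidate d))%type.

Definition cands (x : ctx) : {set candidate d} :=
  [set c | match c with
           | inl (j, _) => j \notin unzip1 x.1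
           | inr j => lasso && (j \in unzip1 x.1)
           end &
           if x.2 is Some (st, e) then c != banned st e else true].

Definition cden st c : R :=
  let A := unzip1 st in
  let sg := signvec (size A) (unzip2 st) in
  match c with
  | inl (j, s) =>
      (-1) ^+ s - ((col j X)^T *m cols X A *m invmx (gram X A) *m sg) 0 0
  | inr j => ((basis_at A j)^T *m invmx (gram X A) *m sg) 0 0
  end.

(* c_l(j, s) and d_l(j) *)
Definition cvec st c : 'cV[R]_n :=
  let A := unzip1 st in
  match c with
  | inl (j, _) => (cden st c)^-1 *: (Pperp X A *m col j X)
  | inr j => (cden st c)^-1 *: (cols X A *m invmx (gram X A) *m basis_at A j)
  end.

(* lambda_(l-1), with lambda_0 = +oo *)
Definition prev_knot (y : 'cV[R]_n) (x : ctx) : \bar R :=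
  if x.2 is Some (st, e) then (dotp (cvec st e) y)%:E else +oo%E.

Fixpoint path_ctx st (prev : option (state * candidate d))
    (M : seq (path_step d)) : seq (ctx * path_step d) :=
  if M is (_, _, (_, e)) as m :: M' then
    ((st, prev), m) :: path_ctx (update st e) (Some (st, e)) M'
  else [::].

Definition path_ok (y : 'cV[R]_n) (z : ctx * path_step d) : Prop :=
  let: (x, (A', s, (E, e))) := z in
  let val c := dotp (cvec x.1 c) y in
  [/\ A' = unzip1 (update x.1 e) /\ sign_ok X y A' s,
      E \subset cands x,
      forall c, c \in cands x ->
        if c \in E then ((val c)%:E <= prev_knot y x)%E
        else (prev_knot y x <= (val c)%:E)%E,
      e \in E /\ forall c, c \in E -> val c <= val e &
      0 <= val e].

Definition path_rows (z : ctx * path_step d) : seq 'rV[R]_n :=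
  let: (x, (A', s, (E, e))) := z in
  let v c := (cvec x.1 c)^T in
  sign_rows X A' s ++
  (if x.2 is Some (st, e0) then
     [seq (if c \in E then (cvec st e0)^T - v c else v c - (cvec st e0)^T)
        | c in cands x]
   else [::]) ++
  [seq v e - v c | c in E] ++ [:: v e].

Definition path_regular (z : ctx * path_step d) : Prop :=
  let: (x, (A', _, _)) := z in
  gram X A' \in unitmx /\ forall c, c \in cands x -> cden x.1 c != 0.

End path_procedures.

Section selection.
Context {R : realType} {d k : nat} {p : procedure}.

(* \hat M(X, y) = M *)
Definition selected n (X : 'M[R]_(n, d)) (y : 'cV[R]_n) (M : model p d k)
    : Prop :=
  match p return model p d k -> Prop with
  | FS => fun M => forall x, x \in fs_ctx M -> fs_ok X y x
  | LAR => fun M => forall z, z \in path_ctx [::] None M -> path_ok false X y z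
  | Lasso => fun M => forall z, z \in path_ctx [::] None M -> path_ok true X y z
  end M.

(* Existence of the inverses and reciprocals occurring in the conditions that
   define the event [selected]. *)
Definition regular n (X : 'M[R]_(n, d)) (M : model p d k) : Prop :=
  match p return model p d k -> Prop with
  | FS => fun M => forall x, x \in fs_ctx M -> fs_regular X x
  | LAR => fun M => forall z, z \in path_ctx [::] None M -> path_regular false X z
  | Lasso => fun M => forall z, z \in path_ctx [::] None M -> path_regular true X z
  end M.

Definition rows n (X : 'M[R]_(n, d)) (M : model p d k) : seq 'rV[R]_n :=
  match p return model p d k -> seq 'rV[R]_n with
  | FS => fun M => flatten [seq fs_rows X x | x <- fs_ctx M]
  | LAR => fun M =>
      flatten [seq path_rows false X z | z <- path_ctx [::] None M]
  | Lasso => fun M =>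
      flatten [seq path_rows true X z | z <- path_ctx [::] None M]
  end M.

Definition nzrows n (X : 'M[R]_(n, d)) (M : model p d k) : seq 'rV[R]_n :=
  [seq r <- rows X M | r != 0].

Definition Qmat n (X : 'M[R]_(n, d)) (M : model p d k)
    : 'M[R]_(size (nzrows X M), n) :=
  \matrix_(i < size (nzrows X M)) tnth (in_tuple (nzrows X M)) i.

End selection.

Definition achievable (R : realType) (p : procedure) (d k : nat)
    : set (model p d k) :=
  [set M | exists n (X : 'M[R]_(n, d)) (y : 'cV[R]_n),
             regular X M /\ selected X y M].

Section selection_event.
Context {R : realType} {d : nat}.

Lemma sign_rowsP n (X : 'M[R]_(n, d)) y A s : size s = size A ->
  sign_ok X y A s <->
  forall r, r \in sign_rows X A s -> 0 <= (r *m y) 0 0.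
Proof.
move=> sA.
have rowE (i : 'I_(size A)) (a : R) :
    (a *: row i (lscoef X A) *m y) 0 0 = a * (lscoef X A *m y) i 0.
  by rewrite -scalemxAl mxE -row_mul mxE.
split=> [[_ h] r rs|h]; first by have [i _ ->] := fintype.imageP rs; rewrite rowE.
by split=> // i; rewrite -rowE; apply/h/fintype.imageP; exists i.
Qed.

Lemma fs_rowsP n0 (X0 : 'M[R]_(n0, d)) y0 n (X : 'M[R]_(n, d)) y x :
  fs_ok X0 y0 x ->
  fs_ok X y x <-> forall r, r \in fs_rows X x -> 0 <= (r *m y) 0 0.
Proof.
case: x => A [A' s] /= [j [jA A'E [sA' _] _]].
have rowE (a b : R) i l : ((a *: fs_vec X A l - b *: fs_vec X A i) *m y) 0 0 =
    a * (fs_vec X A l *m y) 0 0 - b * (fs_vec X A i *m y) 0 0.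
  by rewrite mulmxBl -!scalemxAl !mxE.
split=> [[l [lA A'l sg h]] r|h].
  rewrite mem_cat => /orP[|rs].
    exact: ((sign_rowsP X y sA').1 sg).
  have [[[l' i] b] /and3P[/= l'A' l'A iA'] ->] := fintype.imageP rs.
  suff -> : l' = l by rewrite rowE subr_ge0 h.
  by apply/eqP; move: l'A'; rewrite A'l mem_rcons inE (negbTE l'A) orbF.
exists j; split=> //.
  by apply: (sign_rowsP X y sA').2 => r rs; apply: h; rewrite mem_cat rs.
move=> i b iA'; rewrite -subr_ge0 -rowE; apply: h; rewrite mem_cat.
apply/orP; right; apply/fintype.imageP; exists (j, i, b) => //.
by rewrite !inE /= A'E mem_rcons mem_head jA -A'E.
Qed.

Lemma path_rowsP b n0 (X0 : 'M[R]_(n0, d)) y0 n (X : 'M[R]_(n, d)) y z :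
  path_ok b X0 y0 z ->
  path_ok b X y z <-> forall r, r \in path_rows b X z -> 0 <= (r *m y) 0 0.
Proof.
case: z => x [[A' s] [E e]] /= [[A'E [sA' _]] Ec E0 [eE _] _].
have rowE (u w : 'cV[R]_n) : ((u^T - w^T) *m y) 0 0 = dotp u y - dotp w y.
  by rewrite mulmxBl !mxE /dotp !mxE.
split=> [[[_ sg] _ hE [_ he] e0] r|h].
  rewrite !mem_cat => /or4P[|||].
  - exact: ((sign_rowsP X y sA').1 sg).
  - move: hE; rewrite /prev_knot; case: x.2 => // -[st e1] hE.
    move=> rs; have [c /hE + ->] := fintype.imageP rs.
    by case: ifP => _; rewrite lee_fin rowE subr_ge0.
  - by move=> rs; have [c cE ->] := fintype.imageP rs; rewrite rowE subr_ge0 he.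
  - by rewrite inE => /eqP->.
split=> //.
- split=> //; apply: (sign_rowsP X y sA').2 => r rs.
  by apply: h; rewrite !mem_cat rs.
- move=> c cC; move: (E0 c cC) h; rewrite /prev_knot.
  case: x.2 => [[st e1]|]; last first.
    by case: ifP => _ +; rewrite ?leey// leNgt ltey.
  move=> _ h.
  have := h (if c \in E then (cvec X st e1)^T - (cvec X x.1 c)^T
             else (cvec X x.1 c)^T - (cvec X st e1)^T).
  rewrite !mem_cat (fintype.image_f (fun c0 => if c0 \in E then _ else _) cC) orbT.
  by move=> /(_ isT); case: ifP => _; rewrite rowE subr_ge0 lee_fin.
- split=> // c cE; rewrite -subr_ge0 -rowE; apply: h.
  rewrite !mem_cat (fintype.image_f (fun c0 => (cvec X x.1 e)^T - (cvec X x.1 c0)^T) cE).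
  by rewrite !orbT.
- by apply: h; rewrite !mem_cat mem_head !orbT.
Qed.

Lemma QmatP p k n (X : 'M[R]_(n, d)) (y : 'cV[R]_n) (M : model p d k) :
  (forall i, 0 <= (Qmat X M *m y) i 0) <->
  forall r, r \in rows X M -> 0 <= (r *m y) 0 0.
Proof.
have QE i : (Qmat X M *m y) i 0 = (tnth (in_tuple (nzrows X M)) i *m y) 0 0.
  have <- : row i (Qmat X M) = tnth (in_tuple (nzrows X M)) i by rewrite rowK.
  by rewrite -row_mul [RHS]mxE.
split=> h.
  move=> r rM; have [->|r0] := eqVneq r 0; first by rewrite mul0mx mxE.
  have rn : r \in in_tuple (nzrows X M) by rewrite mem_filter r0.
  by have /tnthP[i ->] := rn; rewrite -QE.
move=> i; rewrite QE; apply: h.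
by have := mem_tnth i (in_tuple (nzrows X M)); rewrite mem_filter => /andP[].
Qed.

Lemma selectedP p k n (X : 'M[R]_(n, d)) (y : 'cV[R]_n) (M : model p d k) :
  achievable R M ->
  selected X y M <-> forall i, 0 <= (Qmat X M *m y) i 0.
Proof.
move=> [n0 [X0 [y0 [_ sel0]]]].
suff H : selected X y M <-> forall r, r \in rows X M -> 0 <= (r *m y) 0 0.
  exact: iff_trans H (iff_sym (QmatP X y M)).
case: p M sel0 => M sel0 /=.
- split=> [h r /flattenP[_ /mapP[x xM ->]]|h x xM].
    apply: (fs_rowsP X y (sel0 x xM)).1; first exact: h.
  apply: (fs_rowsP X y (sel0 x xM)).2 => r rx; apply: h.
  by apply/flattenP; exists (fs_rows X x) => //; exact: map_f.
- split=> [h r /flattenP[_ /mapP[x xM ->]]|h x xM].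
    apply: (path_rowsP X y (sel0 x xM)).1; first exact: h.
  apply: (path_rowsP X y (sel0 x xM)).2 => r rx; apply: h.
  by apply/flattenP; exists (path_rows false X x) => //; exact: map_f.
- split=> [h r /flattenP[_ /mapP[x xM ->]]|h x xM].
    apply: (path_rowsP X y (sel0 x xM)).1; first exact: h.
  apply: (path_rowsP X y (sel0 x xM)).2 => r rx; apply: h.
  by apply/flattenP; exists (path_rows true X x) => //; exact: map_f.
Qed.

End selection_event.

Section truncated_gaussian.
Context {R : realType}.

Definition Phi (x : \bar R) : R :=
  fine (normal_prob (0 : R) 1 [set z : R | (z%:E <= x)%E]).

Definition TG m n (Q : 'M[R]_(m, n)) (y v : 'cV[R]_n) (sigma mu : R) : R :=
  let w := (l2norm v ^- 2) *: (Q *m v) in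
  let ratio i := ((Q *m y) i 0 / w i 0)%:E in
  let vy := (dotp v y)%:E in
  let a := (vy - \big[mine/+oo]_(i < m | (0 < w i 0)%R) ratio i)%E in
  let b := (vy - \big[maxe/-oo]_(i < m | (w i 0 < 0)%R) ratio i)%E in
  let F x := Phi ((x - mu%:E) * ((sigma * l2norm v)^-1)%:E)%E in
  (F b - F vy) / (F b - F a).

Definition TGstat p d k n (X : 'M[R]_(n, d)) (y : 'cV[R]_n) (M : model p d k)
    (v : 'cV[R]_n) (sigma mu : R) : R :=
  TG (Qmat X M) y v sigma mu.

(* The value does not depend on the order in which [A] is enumerated. *)
Definition contrast n d (X : 'M[R]_(n, d)) (A : {set 'I_d}) (j : 'I_d)
    : 'cV[R]_n :=
  let e := basis_at (enum A) j in
  let Gi := invmx (gram X (enum A)) in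
  (Num.sqrt ((e^T *m Gi *m e) 0 0))^-1 *: (cols X (enum A) *m Gi *m e).

Definition Omega n d (X : 'M[R]_(n, d)) (y : 'cV[R]_n) : 'M[R]_d * 'cV[R]_d :=
  (n%:R^-1 *: (X^T *m X), (Num.sqrt n%:R)^-1 *: (X^T *m y)).

End truncated_gaussian.

Section random_vectors.
Context {dT : measure_display} {T : measurableType dT} {R : realType}.
Variable P : probability T R.

Definition Emx m n (Z : T -> 'M[R]_(m, n)) : 'M[R]_(m, n) :=
  \matrix_(i, j) fine ('E_P[fun t => Z t i j])%E.

Definition EOmega n d (X : 'M[R]_(n, d)) (Y : T -> 'cV[R]_n)
    : 'M[R]_d * 'cV[R]_d :=
  (Emx (fun t => (Omega X (Y t)).1), Emx (fun t => (Omega X (Y t)).2)).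

Definition observation n (theta : 'cV[R]_n) (eps : 'I_n -> {RV P >-> R})
    (t : T) : 'cV[R]_n :=
  \col_i (theta i 0 + eps i t).

(* Taking [B i = setT] for some of the [i] gives the product rule for every
   subfamily. *)
Definition iid n (eps : 'I_n -> {RV P >-> R}) : Prop :=
  (forall B : 'I_n -> set R, (forall i, measurable (B i)) ->
     P (\bigcap_(i in [set: 'I_n]) (eps i @^-1` B i)) =
     (\prod_(i < n) P (eps i @^-1` B i))%E) /\
  (forall i j (B : set R), measurable B ->
     distribution P (eps i) B = distribution P (eps j) B).

Definition mean_zero (Z : {RV P >-> R}) : Prop :=
  P.-integrable setT (EFin \o Z) /\ ('E_P[Z] = 0)%E.

Definition gaussian (sigma : R) (Z : {RV P >-> R}) : Prop :=
  forall B : set R, measurable B ->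
    distribution P Z B = normal_prob (0 : R) sigma B.

Definition condprob (E F : set T) : R := fine (P (E `&` F)) / fine (P F).

End random_vectors.

(* Main.v *)
Require Import Defs.
From HB Require Import structures.
From mathcomp Require Import all_boot all_order all_algebra.
From mathcomp Require Import all_classical all_reals all_analysis.
From mathcomp Require Import measurable_realfun ring lra.
From Stdlib Require List.

Set Implicit Arguments.
Unset Strict Implicit.
Unset Printing Implicit Defensive.

Import Order.TTheory GRing.Theory Num.Theory.
Import numFieldNormedType.Exports.
Local Open Scope classical_set_scope.
Local Open Scope ring_scope.

(* Functions of Omega: if (X, y) with n rows and (X', y') with n' rows have the same Omega, then
   X'^T X' = q^-2 X^T X and X'^T y' = q^-1 X^T y with q = sqrt (n / n').  The rows of Q_M and
   the contrast v are of the form X c, with coefficients c that depend on X only through X^T X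
   and, when X is replaced by X', change only by a power of q.  Hence v^T y is the same for
   both designs, the ratios entering the endpoints a and b are equal, and so is the TG
   statistic: v^T y and T factor through Omega, which is affine in y, so that
   E Omega = Omega (X, theta).

   Pivot: replacing the coordinate of the noise along the unit vector v by an independent
   N(0, sigma^2) variable does not change the law of the noise.  This holds for the
   coordinate vectors by independence, and passes to r u + c e, with u, e orthonormal and
   r^2 + c^2 = 1, because N (x) N is invariant under plane rotations.  The endpoints a and b
   do not depend on this coordinate, so conditionally on the rest v^T Y is N(mu, sigma^2)
   truncated to [a, b], and one minus its distribution function is uniform. *)

(** * Affine changes of variable on the line *)

Section affine_substitution.
Context {R : realType}.
Notation mu := (@lebesgue_measure R).

Lemma measurable_affine (a b : R) : measurable_fun setT (fun z : R => a * z + b).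
Proof. by apply: measurable_funD => //; exact: mulrl_measurable. Qed.

Let affine (a b : R) (z : measurableTypeR R) : measurableTypeR R := a * z + b.

Let maffine a b : measurable_fun setT (affine a b) := measurable_affine a b.

(** By uniqueness of Lebesgue measure it suffices to compare half-open intervals. For [a < 0] the
    preimage is closed at the other end, with the same length. *)
Lemma lebesgue_measure_affine (a b : R) (a0 : a != 0) (A : set R) : measurable A ->
  mu A = (`|a|%:E * mu (affine a b @^-1` A))%E.
Proof.
have na0 : 0 <= `|a| by [].
move=> mA.
pose m := (mscale (NngNum na0) (pushforward mu (affine a b))).
rewrite -[RHS]/(m (maffine a b) A).
apply: lebesgue_measure_unique => // _ [[x y] /= _ <-].
rewrite -[RHS]/(`|a|%:E * mu (affine a b @^-1` `]x, y]))%E.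
have [ap|an|/eqP] := ltgtP a 0; last by rewrite (negbTE a0).
- rewrite (_ : _ @^-1` _ = `[(y - b) / a, (x - b) / a[%classic); last first.
    apply/seteqP; split => z; rewrite /= /affine !in_itv /=;
     by rewrite ler_ndivrMr// ltr_ndivlMr// ltrBlDr lerBrDr (mulrC a) andbC.
  rewrite !lebesgue_measure_itv /= !lte_fin ltr_nM2r ?invr_lt0// ltrD2r.
  case: ifPn => xy; last by rewrite mule0.
  rewrite -!EFinD -EFinM ltr0_norm//; congr (_%:E); field.
  by [].
- rewrite (_ : _ @^-1` _ = `](x - b) / a, (y - b) / a]%classic); last first.
    apply/seteqP; split => z; rewrite /= /affine !in_itv /=;
     by rewrite ler_pdivlMr// ltr_pdivrMr// ltrBlDr lerBrDr (mulrC a).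
  rewrite !lebesgue_measure_itv /= !lte_fin ltr_pM2r ?invr_gt0// ltrD2r.
  case: ifPn => xy; last by rewrite mule0.
  rewrite -!EFinD -EFinM gtr0_norm//; congr (_%:E); field.
  by [].
Qed.

Lemma ge0_integral_affine (a b : R) (G : R -> \bar R) : a != 0 ->
  measurable_fun setT G -> (forall x, 0 <= G x)%E ->
  (\int[mu]_x G x = `|a|%:E * \int[mu]_x G (a * x + b)%R)%E.
Proof.
move=> a0 mG G0.
have na0 : 0 <= `|a| by [].
pose m := (mscale (NngNum na0) (pushforward mu (affine a b))).
transitivity (\int[m (maffine a b)]_x G x)%E.
  apply: eq_measure_integral => A mA _; exact: lebesgue_measure_affine.
rewrite ge0_integral_mscale//; congr *%E.
by rewrite ge0_integral_pushforward.
Qed.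

End affine_substitution.

(** * Integration against the normal law through its density *)

Section normal_integral.
Context {R : realType}.
Notation mu := (@lebesgue_measure R).
Local Open Scope ereal_scope.

(** The Radon-Nikodym derivative [g] and the explicit density have equal integrals over every
    measurable set, so they agree almost everywhere. *)
Lemma ge0_integral_normal_prob (m s : R) (f : R -> \bar R) :
  measurable_fun setT f -> (forall x, 0 <= f x) ->
  \int[normal_prob m s]_x f x = \int[mu]_x (f x * (normal_pdf m s x)%:E).
Proof.
move=> mf f0.
have dom := normal_prob_dominates m s.
pose g := Radon_Nikodym_SigmaFinite.f (normal_prob m s) mu.
have ig : mu.-integrable setT g by exact: Radon_Nikodym_SigmaFinite.f_integrable.
have mp : measurable_fun setT (fun x => (normal_pdf m s x)%:E).
  by apply/measurable_EFinP; exact: measurable_normal_pdf.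
rewrite -(Radon_Nikodym_SigmaFinite.change_of_variables dom f0)//.
apply: ge0_ae_eq_integral => //.
- by apply: emeasurable_funM => //; exact: measurable_int ig.
- exact: emeasurable_funM.
- by move=> x _; rewrite mule_ge0//; exact: Radon_Nikodym_SigmaFinite.f_ge0.
- by move=> x _; rewrite mule_ge0// lee_fin normal_pdf_ge0.
- apply: ae_eqe_mul2l; apply: integral_ae_eq => // E _ mE.
  by rewrite -Radon_Nikodym_SigmaFinite.f_integral.
Qed.

End normal_integral.

(** * Plane reflections preserve Lebesgue measure and the standard product normal law up to scale *)

Section lebesgue_reflection.
Context {R : realType}.
Notation mu := (@lebesgue_measure R).
Local Open Scope ereal_scope.

(** The reflection is a composite of two one-variable substitutions separated by Tonelli: first [z]
    is replaced by [a = r x + c z] with [x] fixed, then [x] by [b = (x - r a) / c] with [a] fixed.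
    The Jacobian factors are inverse to each other. *)
Lemma ge0_integral_reflection (c r : R) (K : R * R -> \bar R) : (c != 0)%R ->
  (c ^+ 2 + r ^+ 2 = 1)%R -> measurable_fun setT K -> (forall x, 0 <= K x) ->
  \int[mu]_x \int[mu]_z K (r * x + c * z, c * x - r * z)%R =
  \int[mu]_a \int[mu]_b K (a, b).
Proof.
move=> c0 cr mK K0.
have ic0 : (c^-1 != 0)%R by rewrite invr_eq0.
(* [H (x, a)] is the integrand in the mixed coordinates: one input [x] and one output [a]. *)
pose H (u : R * R) := K (u.2, c^-1 * u.1 + - (r * u.2 / c))%R.
have mH : measurable_fun setT H.
  apply: (measurableT_comp mK); apply: measurable_fun_pair => //.
  apply: measurable_funD; first by apply: measurableT_comp => //; exact: mulrl_measurable.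
  apply: measurable_funN; apply: measurable_funM => //.
  by apply: measurableT_comp => //; exact: mulrl_measurable.
have H0 u : 0 <= H u by exact: K0.
transitivity (\int[mu]_x (`|c^-1|%:E * \int[mu]_a H (x, a))).
  apply: eq_integral => x _.
  have mHx : measurable_fun setT (fun a => H (x, a)).
    exact: (measurableT_comp mH (pair1_measurable x)).
  rewrite [in RHS](ge0_integral_affine (r * x)%R c0 mHx (fun a => H0 (x, a))).
  rewrite muleA -EFinM -normrM mulVf// normr1 mul1e.
  apply: eq_integral => z _; rewrite /H /=.
  have -> : (c^-1 * x + - (r * (c * z + r * x) / c) = c * x - r * z)%R.
    have -> : (c^-1 * x = c^-1 * (c ^+ 2 + r ^+ 2) * x)%R by rewrite cr mulr1.
    by field.
  by rewrite [(c * z + _)%R]addrC.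
transitivity (`|c^-1|%:E * \int[mu]_x \int[mu]_a H (x, a)).
  apply: ge0_integralZl => //.
  - exact: (measurable_fun_fubini_tonelli_F (m2 := mu) _ mH).
  - by move=> x _; apply: integral_ge0.
transitivity (`|c^-1|%:E * \int[mu]_a \int[mu]_x H (x, a)).
  apply: (congr1 (fun e => `|c^-1|%:E * e)).
  exact: (@fubini_tonelli _ _ _ _ _ mu mu _ mH H0).
transitivity (\int[mu]_a (`|c^-1|%:E * \int[mu]_x H (x, a))).
  apply/esym; apply: ge0_integralZl => //.
  - exact: (measurable_fun_fubini_tonelli_G (m1 := mu) _ mH).
  - by move=> x _; apply: integral_ge0.
apply: eq_integral => a _.
have mKa : measurable_fun setT (fun b => K (a, b)).
  exact: (measurableT_comp mK (pair1_measurable a)).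
exact/esym/(ge0_integral_affine (- (r * a / c))%R ic0 mKa (fun b => K0 (a, b))).
Qed.

End lebesgue_reflection.

Section normal_reflection.
Context {R : realType} (s : R) (s0 : (s != 0)%R).
Notation mu := (@lebesgue_measure R).
Local Notation N := (normal_prob 0%R s).
Local Notation p := (normal_pdf 0%R s).
Local Open Scope ereal_scope.

Let mpE : measurable_fun setT (fun x => (p x)%:E).
Proof. by apply/measurable_EFinP; exact: measurable_normal_pdf. Qed.

Let pM (a b a' b' : R) : (a ^+ 2 + b ^+ 2 = a' ^+ 2 + b' ^+ 2)%R ->
  (p a * p b = p a' * p b')%R.
Proof.
move=> h; rewrite normal_pdfE// /normal_fun mulrACA [RHS]mulrACA -!expRD.
congr (_ * expR _)%R; rewrite -!mulrDl !subr0.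
by congr (_ * _)%R; lra.
Qed.

(** The product density depends only on the sum of squares, which the reflection preserves, as it
    does Lebesgue measure. *)
Lemma normal_prob_reflection (c r : R) (F : R * R -> \bar R) : (c != 0)%R ->
  (c ^+ 2 + r ^+ 2 = 1)%R -> measurable_fun setT F -> (forall x, 0 <= F x) ->
  \int[N]_x \int[N]_z F (r * x + c * z, c * x - r * z)%R =
  \int[N]_a \int[N]_b F (a, b).
Proof.
move=> c0 cr mF F0.
pose K (u : R * R) := F u * (p u.1 * p u.2)%:E.
have K0 u : 0 <= K u by rewrite mule_ge0// lee_fin mulr_ge0// normal_pdf_ge0.
have mK : measurable_fun setT K.
  apply: emeasurable_funM => //; apply/measurable_EFinP.
  by apply: measurable_funM; apply: measurableT_comp => //;
    exact: measurable_normal_pdf.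
have dens (h : R -> R -> \bar R) : (forall x z, 0 <= h x z) ->
    measurable_fun setT (fun u : R * R => h u.1 u.2) ->
    \int[N]_x \int[N]_z h x z =
    \int[mu]_x \int[mu]_z (h x z * (p x * p z)%:E).
  move=> h0 mh.
  rewrite ge0_integral_normal_prob; last 2 first.
  - exact: (measurable_fun_fubini_tonelli_F (m2 := N) (fun u => h u.1 u.2)).
  - by move=> x; apply: integral_ge0.
  apply: eq_integral => x _.
  have mhx : measurable_fun setT (h x).
    by apply: (measurableT_comp mh (pair1_measurable x)).
  rewrite ge0_integral_normal_prob// -ge0_integralZr//.
  - by apply: eq_integral => z _; rewrite -muleA -EFinM mulrC.
  - exact: emeasurable_funM.
  - by move=> z _; rewrite mule_ge0// lee_fin normal_pdf_ge0.
  - by rewrite lee_fin normal_pdf_ge0.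
transitivity (\int[mu]_a \int[mu]_b K (a, b)); last first.
  apply/esym; apply: (dens (fun a b => F (a, b))) => //.
  by apply: (eq_measurable_fun F) => // -[].
pose H x z := F (r * x + c * z, c * x - r * z)%R.
transitivity (\int[mu]_x \int[mu]_z (H x z * (p x * p z)%:E)).
  apply: (dens H) => // [x z|]; first exact: F0.
  apply: (measurableT_comp mF); apply: measurable_fun_pair.
    by apply: measurable_funD; apply: measurableT_comp => //; exact: mulrl_measurable.
  by apply: measurable_funB; apply: measurableT_comp => //; exact: mulrl_measurable.
transitivity (\int[mu]_x \int[mu]_z K (r * x + c * z, c * x - r * z)%R).
  apply: eq_integral => x _; apply: eq_integral => z _.
  rewrite /K /H; congr (_ * _%:E); apply: pM.
  by rewrite -[LHS]mul1r -cr /=; ring.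
exact: ge0_integral_reflection.
Qed.

End normal_reflection.

(** * Resampling a vector along a direction *)

Section resampling.
Context {R : realType} (s : R) (s0 : (s != 0)%R) (n : nat).
Local Notation N := (normal_prob 0 s).
Implicit Types (u v e : 'I_n -> R) (y : n.-tuple R).

(* For a unit vector v: y with its coordinate along v replaced by x. *)
Definition resample v y (x : R) : n.-tuple R :=
  [tuple tnth y i + v i * (x - \sum_k v k * tnth y k) | i < n].

Lemma measurable_resample v :
  measurable_fun setT (fun z : n.-tuple R * R => resample v z.1 z.2).
Proof.
apply/measurable_fun_tnthP => i.
apply: (eq_measurable_fun (fun z : n.-tuple R * R =>
    tnth z.1 i + v i * (z.2 - \sum_k v k * tnth z.1 k))) => [z _|].
  by rewrite /= tnth_mktuple.
have mt k : measurable_fun setT (fun z : n.-tuple R * R => tnth z.1 k).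
  by apply: (measurableT_comp (measurable_tnth k)).
apply: measurable_funD => //; apply: measurable_funM => //.
apply: measurable_funB => //; apply: measurable_sum => k.
exact: measurable_funM.
Qed.

(** Invariance of [nu] under an independent redraw of the coordinate along [v]. It is stated for
    nonnegative functions rather than sets so that it can be applied again to the resulting inner
    integral. *)
Definition resamplable (nu : probability (n.-tuple R) R) v :=
  forall f : n.-tuple R -> \bar R, measurable_fun setT f -> (forall y, 0 <= f y)%E ->
  (\int[nu]_y f y = \int[nu]_y \int[N]_x f (resample v y x))%E.

Lemma measurable_resample_integral v (f : n.-tuple R -> \bar R) :
  measurable_fun setT f -> (forall y, 0 <= f y)%E ->
  measurable_fun setT (fun y => \int[N]_x f (resample v y x))%E.
Proof.
move=> mf f0.
apply: (measurable_fun_fubini_tonelli_F (m2 := N) (fun z => f (resample v z.1 z.2))) => //.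
exact: (measurableT_comp mf (measurable_resample v)).
Qed.

(** [D a b] gives [y] the coordinates [a] and [b] along [u] and [e]. Setting the coordinate along
    [r u + c e] to [x] keeps the one along [c u - r e], which is [z]; rotating back yields the
    coordinates [r x + c z] and [c x - r z]. *)
Lemma resample_rotation u e (r c : R) y w t x :
  \sum_k u k ^+ 2 = 1 -> \sum_k e k ^+ 2 = 1 -> \sum_k u k * e k = 0 ->
  r ^+ 2 + c ^+ 2 = 1 ->
  let D a b := resample e (resample u y a) b in
  let z := c * w - r * t in
  resample (fun k => r * u k + c * e k) (D w t) x =
  D (r * x + c * z) (c * x - r * z).
Proof.
move=> u1 e1 ue rc /=.
pose dot v y := \sum_k v k * tnth y k.
have dot_res v v' y' a : dot v (resample v' y' a) =
    dot v y' + (\sum_k v k * v' k) * (a - dot v' y').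
  rewrite /dot mulr_suml -big_split /=; apply: eq_bigr => k _.
  by rewrite tnth_mktuple mulrDr mulrA.
have dotD r' c' v v' y' : dot (fun k => r' * v k + c' * v' k) y' =
    r' * dot v y' + c' * dot v' y'.
  rewrite /dot !mulr_sumr -big_split /=; apply: eq_bigr => k _.
  by rewrite mulrDl !mulrA.
have uu : \sum_k u k * u k = 1 by rewrite -u1; apply: eq_bigr => k _.
have ee : \sum_k e k * e k = 1 by rewrite -e1; apply: eq_bigr => k _.
have eu : \sum_k e k * u k = 0 by rewrite -[RHS]ue; apply: eq_bigr => k _; rewrite mulrC.
apply: eq_from_tnth => i; rewrite !tnth_mktuple.
rewrite -/(dot (fun k => r * u k + c * e k) _) dotD -!/(dot _ _) !dot_res.
rewrite uu ee ue eu !mul0r !addr0 !mul1r -/(dot u y) -/(dot e y).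
apply/eqP; rewrite -subr_eq0.
rewrite [X in X == 0](_ : _ = (1 - (r ^+ 2 + c ^+ 2)) * (u i * w + e i * t)).
  by rewrite rc subrr mul0r.
by ring.
Qed.

(** Two reflections. The first one, with parameters [- r] and [c], shows that [z = c w - r t] has
    law [N]; its other component integrates out with mass one. The second one acts on the
    independent pair [x], [z]. *)
Lemma normal_prob_rotation (r c : R) (F : R * R -> \bar R) : r != 0 -> c != 0 ->
  r ^+ 2 + c ^+ 2 = 1 -> measurable_fun setT F -> (forall z, 0 <= F z)%E ->
  (\int[N]_w \int[N]_t \int[N]_x
     F (r * x + c * (c * w - r * t), c * x - r * (c * w - r * t))%R =
   \int[N]_a \int[N]_b F (a, b))%E.
Proof.
move=> r0 c0 rc mF F0.
have cr : c ^+ 2 + r ^+ 2 = 1 by rewrite addrC.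
pose F1 (p : R * R) := F (r * p.2 + c * p.1, c * p.2 - r * p.1).
have mF1 : measurable_fun setT F1.
  apply: (measurableT_comp mF); apply: measurable_fun_pair.
    by apply: measurable_funD; apply: measurableT_comp => //; exact: mulrl_measurable.
  by apply: measurable_funB; apply: measurableT_comp => //; exact: mulrl_measurable.
have F10 z : (0 <= F1 z)%E by exact: F0.
pose H (z : R) := (\int[N]_x F1 (z, x))%E.
have mH : measurable_fun setT H.
  exact: (measurable_fun_fubini_tonelli_F (m2 := N) _ mF1).
have H0 z : (0 <= H z)%E by apply: integral_ge0 => x _; exact: F10.
have nr0 : - r != 0 by rewrite oppr_eq0.
have rc' : (- r) ^+ 2 + c ^+ 2 = 1 by rewrite sqrrN.
have mH1 : measurable_fun setT (fun p : R * R => H p.1) by apply: measurableT_comp.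
transitivity (\int[N]_z \int[N]_b (fun p : R * R => H p.1) (z, b))%E.
  apply: etrans (normal_prob_reflection s0 nr0 rc' mH1 (fun p => H0 p.1)).
  by apply: eq_integral => w _; apply: eq_integral => t _; rewrite /= mulNr.
transitivity (\int[N]_z H z)%E.
  apply: eq_integral => z _.
  rewrite -[RHS]mule1 -(@probability_setT _ _ _ N).
  exact: (@integral_cst _ _ _ N _ measurableT (H z)).
transitivity (\int[N]_x \int[N]_z F1 (z, x))%E.
  exact: (@fubini_tonelli _ _ _ _ _ N N _ mF1 F10).
exact (normal_prob_reflection s0 c0 cr mF F0).
Qed.

(** Both sides of the claim are first resampled along [u] and then along [e]. For fixed [y] they
    become integrals over the plane spanned by [u] and [e], and these agree by
    [normal_prob_rotation]. *)
Lemma resamplable_rotation nu u e (r c : R) : resamplable nu u -> resamplable nu e ->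
  \sum_k u k ^+ 2 = 1 -> \sum_k e k ^+ 2 = 1 -> \sum_k u k * e k = 0 ->
  r != 0 -> c != 0 -> r ^+ 2 + c ^+ 2 = 1 ->
  resamplable nu (fun k => r * u k + c * e k).
Proof.
move=> Ru Re u1 e1 ue r0 c0 rc f mf f0.
have twice (h : n.-tuple R -> \bar R) : measurable_fun setT h ->
    (forall y, 0 <= h y)%E ->
    (\int[nu]_y h y =
     \int[nu]_y \int[N]_w \int[N]_t h (resample e (resample u y w) t))%E.
  move=> mh h0; rewrite (Re h mh h0).
  apply: (Ru (fun y => \int[N]_t h (resample e y t))%E).
    exact: measurable_resample_integral.
  by move=> y; apply: integral_ge0.
pose v k := r * u k + c * e k; rewrite -/v.
pose h y := (\int[N]_x f (resample v y x))%E.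
have mh : measurable_fun setT h by exact: measurable_resample_integral.
have h0 y : (0 <= h y)%E by apply: integral_ge0.
rewrite (twice f mf f0) (twice h mh h0).
apply: eq_integral => y _.
pose F (z : R * R) := f (resample e (resample u y z.1) z.2).
have mF : measurable_fun setT F.
  apply: (measurableT_comp mf).
  have mD : measurable_fun setT (fun z : R * R => (resample u y z.1, z.2)).
    apply: measurable_fun_pair => //.
    have := measurableT_comp (measurable_resample u) (pair1_measurable y).
    by move=> /measurableT_comp; apply.
  exact: (measurableT_comp (measurable_resample e) mD).
apply: etrans (esym (normal_prob_rotation r0 c0 rc mF (fun z => f0 _))) _.
apply: eq_integral => w _; apply: eq_integral => t _; apply: eq_integral => x _.
by rewrite /F /v resample_rotation.
Qed.

End resampling.

(** * Measures on tuples are determined by boxes *)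

Section box_measure.
Context {R : realType} (n : nat).

Definition box (B : 'I_n -> set R) : set (n.-tuple R) :=
  [set y | forall i, B i (tnth y i)].

Definition boxes : set (set (n.-tuple R)) :=
  [set box B | B in [set B | forall i, measurable (B i)]].

Lemma measurable_box (B : 'I_n -> set R) :
  (forall i, measurable (B i)) -> measurable (box B).
Proof.
move=> mB.
rewrite (_ : box B = \bigcap_(i in [set: 'I_n]) ((@tnth n R)^~ i @^-1` B i)).
  apply: fin_bigcap_measurable => // i _.
  by rewrite -[X in measurable X]setTI; exact: measurable_tnth.
by apply/seteqP; split => y h; [move=> i _; exact: h|move=> i; exact: h].
Qed.

Lemma measurable_tupleE : @measurable _ (n.-tuple R) = <<s boxes>>.
Proof.
apply/seteqP; split.
  apply: smallest_sub; first exact: smallest_sigma_algebra.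
  rewrite -bigcup_seq => _ [i _ [B mB <-]]; rewrite setTI.
  apply: sub_sigma_algebra; exists (fun j => if j == i then B else setT).
    by move=> j /=; case: ifP.
  apply/seteqP; split => y /=; first by move=> /(_ i); rewrite eqxx.
  by move=> By j; case: eqP => // ->.
apply: smallest_sub; first exact: sigma_algebra_measurable.
by move=> _ [B mB <-]; exact: measurable_box.
Qed.

(** Boxes are stable under intersection and generate the sigma-algebra, and the whole space is
    itself a box of finite mass. *)
Lemma eq_measure_boxes (m1 : probability (n.-tuple R) R)
    (m2 : {measure set (n.-tuple R) -> \bar R}) :
  (forall B, (forall i, measurable (B i)) -> m1 (box B) = m2 (box B)) ->
  forall A, measurable A -> m1 A = m2 A.
Proof.
move=> m12; apply: (measure_unique boxes (fun=> setT)).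
- exact: measurable_tupleE.
- move=> _ _ [B mB <-] [C mC <-]; exists (fun i => B i `&` C i).
    by move=> i; exact: measurableI.
  apply/seteqP; split => y /=; last by move=> [h1 h2] i; split; [exact: h1|exact: h2].
  by rewrite /box /= => h; split=> i; have [] := h i.
- by move=> _; exists (fun=> setT) => //; apply/seteqP; split.
- exact: bigcup_const.
- by move=> _ [B mB <-]; exact: m12.
- by move=> k /=; rewrite probability_setT ltry.
Qed.

End box_measure.

(** * Independent normal coordinates can be resampled along any unit vector *)

Section normal_vector.
Context {R : realType} (s : R) (s0 : (s != 0)%R) (n : nat).
Local Notation N := (normal_prob 0 s).

Lemma ge0_integral_normal_probN (f : R -> \bar R) :
  measurable_fun setT f -> (forall x, 0 <= f x)%E ->
  (\int[N]_x f (- x)%R = \int[N]_x f x)%E.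
Proof.
move=> mf f0.
have mfN : measurable_fun setT (fun x : R => f (- x)).
  by apply: measurableT_comp.
rewrite !ge0_integral_normal_prob// [RHS](@ge0_integral_affine _ (-1) 0); last 3 first.
- by rewrite oppr_eq0 oner_eq0.
- apply: emeasurable_funM => //; apply/measurable_EFinP.
  exact: measurable_normal_pdf.
- by move=> x; rewrite mule_ge0// lee_fin normal_pdf_ge0.
rewrite normrN1 mul1e; apply: eq_integral => x _.
by rewrite mulN1r addr0 !normal_pdfE// /normal_fun !subr0 sqrrN.
Qed.

Lemma normal_probN (A : set R) : measurable A -> N (-%R @^-1` A) = N A.
Proof.
move=> mA.
have mA' : measurable (-%R @^-1` A : set R).
  by rewrite -[X in measurable X]setTI; exact: oppr_measurable.
rewrite -[LHS]/(N (-%R @^-1` A : set R)) -[in LHS](setIT (_ @^-1` A)) -[in RHS](setIT A).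
rewrite -!integral_indic//.
apply: (@ge0_integral_normal_probN (fun x => (\1_A x)%:E)) => //.
by apply/measurable_EFinP; exact: measurable_indic.
Qed.

Variable nu : probability (n.-tuple R) R.
Hypothesis nuE : forall B, (forall i, measurable (B i)) ->
  (nu (box B) = \prod_(i < n) N (B i))%E.

(** Resampling replaces the entry [i] by [a * x], so the preimage of a box is a box with side [i]
    free times a condition on [x] alone. The sign [a] is harmless by symmetry of [N]; it occurs when
    a unit vector has a single nonzero entry. *)
Lemma resamplable_coordinate (i : 'I_n) (a : R) : a ^+ 2 = 1 ->
  resamplable s nu (fun k => a * (k == i)%:R).
Proof.
move=> a1 f mf f0; pose v (k : 'I_n) : R := a * (k == i)%:R; rewrite -/v.
have vy y : \sum_k v k * tnth y k = a * tnth y i.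
  rewrite (bigD1 i)//= /v eqxx mulr1 big1 ?addr0// => k /negbTE ->.
  by rewrite mulr0 mul0r.
have resE y x k : tnth (resample v y x) k = if k == i then a * x else tnth y k.
  rewrite tnth_mktuple vy /v; case: eqP => [->|_]; last by rewrite mulr0 mul0r addr0.
  by rewrite mulr1 mulrBr mulrA -expr2 a1 mul1r addrC subrK.
pose phi (z : n.-tuple R * R) := resample v z.1 z.2.
have mphi : measurable_fun setT phi by exact: measurable_resample.
pose m (_ : measurable_fun setT phi) := pushforward (nu \x N)%E phi.
have mE A : measurable A -> nu A = m mphi A.
  apply: eq_measure_boxes => B mB.
  pose B' k := if k == i then setT else B k.
  have mB' k : measurable (B' k) by rewrite /B'; case: ifP.
  have mBa : measurable ((fun x : R => a * x) @^-1` B i).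
    by rewrite -[X in measurable X]setTI; exact: mulrl_measurable.
  rewrite -[RHS]/((nu \x N)%E (phi @^-1` box B)).
  rewrite (_ : phi @^-1` box B = box B' `*` ((fun x : R => a * x) @^-1` B i)).
    rewrite product_measure1E//; last exact: measurable_box.
    transitivity ((\prod_(k < n) N (B' k)) *
        N ((fun x : R => a * x)%R @^-1` B i))%E; last first.
      by congr (_ * _)%E; exact/esym/nuE.
    rewrite nuE// (bigD1 i)//= [X in (_ = X * _)%E](bigD1 i)//= {1}/B' eqxx.
    rewrite [X in (_ = X * _ * _)%E]probability_setT mul1e muleC; congr (_ * _)%E.
      by apply: eq_bigr => k /negbTE ki; rewrite /B' ki.
    move/eqP: a1; rewrite sqrf_eq1 => /orP[]/eqP ->.
      by congr (N _); apply/funext => x /=; rewrite mul1r.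
    rewrite -[LHS]normal_probN//; congr (N _); apply/funext => x /=.
    by rewrite mulN1r.
  apply/seteqP; split => -[y x] /=.
    move=> h; split => [k|]; last by have := h i; rewrite resE eqxx.
    by rewrite /B'; case: eqP => // /eqP/negbTE ki; have := h k; rewrite resE ki.
  move=> [h1 h2] k; rewrite resE; case: eqP => [->//|/eqP/negbTE ki].
  by have := h1 k; rewrite /B' ki.
transitivity (\int[m mphi]_y f y)%E.
  by apply: eq_measure_integral => A mA _; exact: mE.
rewrite ge0_integral_pushforward// preimage_setT.
exact: (@fubini_tonelli1 _ _ _ _ _ nu N _ (measurableT_comp mf mphi) (fun z => f0 _)).
Qed.

(** Induction on a bound [j] for the support. The last entry [c] is split off, [u = r u' + c e],
    with [u'] the normalized remainder, and [resamplable_rotation] applies. The cases [c = 0] and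
    [r = 0] are separate: in the first the support shrinks, in the second [u] is a signed basis
    vector. *)
Lemma resamplable_unit v : \sum_k v k ^+ 2 = 1 -> resamplable s nu v.
Proof.
pose supp j (u : 'I_n -> R) := forall k : 'I_n, (j <= k)%N -> u k = 0.
suff H j : (j <= n)%N -> forall u, supp j u -> \sum_k u k ^+ 2 = 1 -> resamplable s nu u.
  by apply: (H n) => // k; rewrite leqNgt ltn_ord.
elim: j => [_ u u0|j IH jn u uS u1].
  rewrite big1 => [/eqP|k _]; first by rewrite eq_sym oner_eq0.
  by rewrite u0// expr0n.
pose i := Ordinal jn.
pose c := u i.
pose r2 := \sum_(k | k != i) u k ^+ 2.
have r2c : r2 + c ^+ 2 = 1 by rewrite addrC -u1 (bigD1 i).
have r20 : 0 <= r2 by apply: sumr_ge0 => k _; exact: sqr_ge0.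
have [c0|c0] := eqVneq c 0.
  apply: (IH (ltnW jn)) => // k; rewrite leq_eqVlt => /orP[/eqP jk|/uS//].
  by rewrite -c0 /c; congr u; exact: val_inj.
have [r0|r0] := eqVneq r2 0.
  have uE : u = fun k => c * (k == i)%:R.
    apply/funext => k; case: eqP => [->|/eqP ki]; first by rewrite mulr1.
    rewrite mulr0; apply/eqP; rewrite -sqrf_eq0.
    move/eqP: r0; rewrite psumr_eq0 => [/allP/(_ k)|l _]; rewrite ?sqr_ge0// ki.
    by rewrite mem_index_enum => /(_ isT).
  by rewrite uE; apply: resamplable_coordinate; rewrite -r2c r0 add0r.
pose r := Num.sqrt r2.
have rr : r ^+ 2 = r2 by rewrite sqr_sqrtr.
have rN0 : r != 0 by rewrite -sqrf_eq0 rr.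
pose u' k := r^-1 * (if k == i then 0 else u k).
(* The factor 1 gives [e] the shape required by [resamplable_coordinate]. *)
pose e (k : 'I_n) : R := 1 * (k == i)%:R.
have -> : u = fun k => r * u' k + c * e k.
  apply/funext => k; rewrite /u' /e mulVKf// mul1r.
  by case: eqP => [->|_]; rewrite ?mulr1 ?add0r// mulr0 addr0.
have u'1 : \sum_k u' k ^+ 2 = 1.
  rewrite (bigD1 i)//= /u' eqxx mulr0 expr0n add0r.
  under eq_bigr => k /negbTE -> do rewrite exprMn exprVn rr.
  by rewrite -mulr_sumr mulVf.
apply: resamplable_rotation => //.
- apply: (IH (ltnW jn)) => // k jk; rewrite /u'; case: eqP => [_|/eqP ki].
    by rewrite mulr0.
  rewrite uS ?mulr0// ltn_neqAle jk andbT; apply: contra ki => /eqP jk'.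
  by apply/eqP/val_inj.
- by apply: resamplable_coordinate; rewrite expr1n.
- rewrite (bigD1 i)//= /e eqxx mulr1 expr1n big1 ?addr0// => k /negbTE ->.
  by rewrite mulr0 expr0n.
- rewrite big1// => k _; rewrite /u' /e; case: eqP => _.
    by rewrite mulr0 mul0r.
  by rewrite mulr0 mulr0.
- by rewrite rr.
Qed.

End normal_vector.

(** * The normal distribution function and its truncated pivot *)

Section Phi.
Context {R : realType}.
Notation mu := (@lebesgue_measure R).
Local Notation N := (normal_prob (0 : R) 1).
Local Notation p := (normal_pdf (0 : R) 1).

Lemma measurable_le_EFin (x : \bar R) : measurable [set z : R | (z%:E <= x)%E].
Proof.
rewrite (_ : [set _ | _] = EFin @^-1` [set y | (y <= x)%E]); last by [].
rewrite -[X in measurable X]setTI; apply: EFin_measurable => //.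
by have := @emeasurable_itv R `]-oo, x]; rewrite set_itvNyc.
Qed.

Lemma Phi_fin (x : \bar R) : (Phi x)%:E = N [set z : R | (z%:E <= x)%E].
Proof. by rewrite /Phi fineK//; apply: fin_num_measure; exact: measurable_le_EFin. Qed.

Lemma Phi_le : {homo (@Phi R) : x y / (x <= y)%E >-> x <= y}.
Proof.
move=> x y xy; rewrite -lee_fin !Phi_fin.
apply: le_measure; rewrite ?inE; try exact: measurable_le_EFin.
by move=> z /= /le_trans; apply.
Qed.

Lemma Phi_ge0 x : 0 <= @Phi R x. Proof. by rewrite /Phi fine_ge0. Qed.

Lemma Phi_le1 x : @Phi R x <= 1.
Proof. by rewrite -lee_fin Phi_fin; apply: probability_le1; exact: measurable_le_EFin. Qed.

Lemma Phi_diff (w z : R) : w <= z ->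
  (Phi z%:E - Phi w%:E)%:E = (\int[mu]_(x in `]w, z]) (p x)%:E)%E.
Proof.
move=> wz; rewrite EFinB !Phi_fin.
have AB : [set x : R | (x%:E <= z%:E)%E] `&` [set x | (x%:E <= w%:E)%E] =
    [set x | (x%:E <= w%:E)%E].
  by apply/setIidr => x /=; rewrite !lee_fin => /le_trans; apply.
rewrite -[in X in (_ - X)%E]AB -measureD; try exact: measurable_le_EFin; last first.
  apply: (le_lt_trans (@probability_le1 _ _ _ N _ (measurable_le_EFin _))); exact: ltry.
rewrite -[LHS]/(\int[mu]_(x in _) _)%E.
congr (integral _ _ _).
apply/seteqP; split => x /=; rewrite in_itv/= !lee_fin.
  by move=> [-> /negP]; rewrite -ltNge andbT.
by move=> /andP[wx xz]; split => //; apply/negP; rewrite -ltNge.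
Qed.

Let s1 : (1 : R) != 0. Proof. exact: oner_neq0. Qed.

Let mp D : measurable D -> measurable_fun D (fun x => (p x)%:E).
Proof.
move=> mD; apply/measurable_funTS/measurable_EFinP; exact: measurable_normal_pdf.
Qed.

Let itvmu (w z : R) : w <= z -> (mu `]w, z]%classic = (z - w)%:E)%E.
Proof.
rewrite le_eqVlt => /orP[/eqP ->|wz].
  by rewrite set_itvoc0 measure0 subrr.
by rewrite lebesgue_measure_itv/= lte_fin wz -EFinB.
Qed.

Lemma Phi_lipschitz (w z : R) : w <= z ->
  Phi z%:E - Phi w%:E <= normal_peak 1 * (z - w).
Proof.
move=> wz; rewrite -lee_fin Phi_diff// EFinM -itvmu// -integral_cst//=.
apply: ge0_le_integral => //=.
- by move=> x _; rewrite lee_fin normal_pdf_ge0.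
- exact: mp.
- by move=> x _; rewrite lee_fin normal_pdf_ub.
Qed.

Lemma Phi_lt_fin (w z : R) : w < z -> Phi w%:E < Phi z%:E.
Proof.
move=> wz; rewrite -subr_gt0 -lte_fin Phi_diff ?(ltW wz)//.
(* [c] is the density at [M]. Since [|x| <= M] on []w, z]], it bounds the density from below
   there. *)
pose M := `|w| + `|z|; pose c := normal_peak 1 * expR (- M ^+ 2 / (1 ^+ 2 *+ 2)).
have c0 : 0 < c by rewrite mulr_gt0 ?expR_gt0// normal_peak_gt0.
apply: (@lt_le_trans _ _ (\int[mu]_(x in `]w, z]) c%:E)%E).
  rewrite integral_cst//= itvmu ?(ltW wz)// -EFinM lte_fin mulr_gt0// subr_gt0//.
apply: ge0_le_integral => //=.
- by move=> x _; rewrite lee_fin ltW.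
- exact: mp.
move=> x; rewrite in_itv/= => /andP[wx xz].
rewrite lee_fin normal_pdfE// /normal_fun ler_pM2l ?normal_peak_gt0// ler_expR.
rewrite ler_pM2r ?invr_gt0 ?mulrn_wgt0// ?exprn_gt0// lerN2 subr0.
rewrite -[_ ^+ 2]real_normK ?num_real// lerXn2r ?nnegrE ?addr_ge0//.
rewrite /M ler_norml; apply/andP; split; last first.
  by rewrite (le_trans xz)// (le_trans (ler_norm z))// lerDr.
rewrite (le_trans _ (ltW wx))// (le_trans _ (lerNnormlW (lexx `|w|)))//.
by rewrite lerN2 lerDl.
Qed.

Lemma Phi_lt : {homo (@Phi R) : x y / (x < y)%E >-> x < y}.
Proof.
move=> x y xy.
suff [w [z [xw wz zy]]] : exists w z : R, [/\ (x <= w%:E)%E, w < z & (z%:E <= y)%E].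
  by apply: (le_lt_trans (Phi_le xw)); apply: (lt_le_trans (Phi_lt_fin wz)); exact: Phi_le.
case: x y xy => [x| |] [y| |]//=; rewrite ?lte_fin => xy.
- by exists x, y.
- by exists x, (x + 1); rewrite ltrDl leey.
- by exists (y - 1), y; rewrite ltrBlDr ltrDl leNye.
- by exists 0, 1; rewrite leNye leey ltr01.
Qed.

(** The identity as a random variable under [N]: its cdf is [Phi], whose limits at both infinities
    are then those of a cdf. *)
Let idTR : measurableTypeR R -> R := idfun.

#[local] HB.instance Definition _ :=
  @isMeasurableFun.Build _ _ _ _ idTR (@measurable_id _ _ setT).

Let idN : {RV N >-> R} := idTR.

Let cdfN (z : R) : cdf idN z = (Phi z%:E)%:E.
Proof.
rewrite Phi_fin /cdf /distribution /pushforward /=; congr (N _).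
Qed.

(** The limits of the cdf give points with values below and above [q]; the intermediate value
    theorem applies because [Phi] is Lipschitz. *)
Lemma Phi_surj (q : R) : 0 < q < 1 -> exists z : R, Phi z%:E = q.
Proof.
move=> /andP[q0 q1].
have [w wq] : exists w : R, Phi w%:E <= q.
  apply: contrapT => /forallNP H.
  have : (q%:E <= 0)%E; last by rewrite lee_fin leNgt q0.
  apply: cvge_ge (cvg_cdfNy0 idN); near=> x.
  by rewrite cdfN lee_fin ltW// ltNge; apply/negP; exact: H.
have [z zq] : exists z : R, q <= Phi z%:E.
  apply: contrapT => /forallNP H.
  have : (1 <= q%:E)%E; last by rewrite lee_fin leNgt q1.
  apply: cvge_le (cvg_cdfy1 idN); near=> x.
  by rewrite cdfN lee_fin ltW// ltNge; apply/negP; exact: H.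
have wz : w <= z.
  rewrite leNgt; apply/negP => zw; have := Phi_lt_fin zw.
  by rewrite ltNge (le_trans wq zq).
have [c _ <-] : exists2 c, c \in `[w, z] & Phi c%:E = q; last by exists c.
apply: (@IVT R (fun c => Phi c%:E)) => //; last first.
  by rewrite ge_min wq le_max zq orbT.
apply: continuous_subspaceT => x; apply/cvgrPdist_lt => e e0.
have C0 : 0 < normal_peak (1 : R) by exact: normal_peak_gt0.
have lip (a b : R) : `|Phi a%:E - Phi b%:E| <= normal_peak 1 * `|a - b|.
  wlog ab : a b / b <= a.
    move=> h; have [|/ltW] := leP b a; first exact: h.
    by rewrite distrC (distrC a); exact: h.
  by rewrite !ger0_norm ?subr_ge0 ?Phi_le//; exact: Phi_lipschitz.
near=> y.
apply: (le_lt_trans (lip x y)); rewrite mulrC -ltr_pdivlMr//.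
near: y; apply: cvgr_dist_lt => //; by rewrite divr_gt0.
Unshelve. all: by end_near. Qed.

Lemma measurable_Phi_fin : measurable_fun setT (fun z : R => Phi z%:E).
Proof. by apply: nondecreasing_measurable => // a b ab; exact: Phi_le. Qed.

(** The probability integral transform: for [0 < q < 1] the set is the half-line up to a quantile of
    [q], without that point, which is null. *)
Lemma normal_prob_Phi_lt (q : R) : 0 <= q <= 1 -> N [set z | Phi z%:E < q] = q%:E.
Proof.
move=> /andP[]; rewrite le_eqVlt => /orP[/eqP <- _|q0].
  rewrite (_ : [set _ | _] = set0) ?measure0//.
  by apply/seteqP; split => // z /=; rewrite ltNge Phi_ge0.
rewrite le_eqVlt => /orP[/eqP ->|q1].
  rewrite (_ : [set _ | _] = setT) ?probability_setT//.
  apply/seteqP; split => // z _ /=.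
  by rewrite (lt_le_trans _ (Phi_le1 +oo%E))// Phi_lt// ltry.
have [|z zq] := @Phi_surj q; first by rewrite q0.
rewrite (_ : [set _ | _] = [set x : R | (x%:E <= z%:E)%E] `\` [set z]).
  rewrite -[RHS]sube0 -zq Phi_fin.
  have null : N [set z] = 0%E.
    have /null_content_dominatesP := normal_prob_dominates (0 : R) 1.
    by apply => //; exact: lebesgue_measure_set1.
  rewrite -[in RHS]null measureD//; [|exact: measurable_le_EFin|].
    by congr (_ - N _)%E; apply/setIidr => _ -> /=.
  by apply: (le_lt_trans (@probability_le1 _ _ _ N _ (measurable_le_EFin _))); exact: ltry.
apply/seteqP; split => x /=; rewrite -zq lee_fin.
  move=> xz; have xz' : x < z.
    by rewrite ltNge; apply/negP => zx; move: xz; rewrite ltNge Phi_le.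
  by split; [exact: ltW|move=> xE; rewrite xE ltxx in xz'].
by move=> [xz /eqP zx]; apply: Phi_lt_fin; rewrite lt_neqAle zx.
Qed.

Lemma normal_prob_Phi_itv (q : R) (b : \bar R) : 0 <= q <= Phi b ->
  N [set z | q <= Phi z%:E /\ (z%:E <= b)%E] = (Phi b - q)%:E.
Proof.
move=> /andP[q0 qb].
have mq : measurable [set z : R | Phi z%:E < q].
  have := measurable_Phi_fin measurableT (measurable_itv `]-oo, q[); rewrite setTI.
  by congr measurable; apply/seteqP; split => x /=; rewrite in_itv.
rewrite EFinB Phi_fin -(@normal_prob_Phi_lt q) ?q0 ?(le_trans qb) ?Phi_le1//.
have AB : [set x : R | (x%:E <= b)%E] `&` [set z | Phi z%:E < q] =
    [set z | Phi z%:E < q].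
  apply/setIidr => x /= xq; rewrite leNgt; apply/negP => /ltW/Phi_le.
  by rewrite leNgt (lt_le_trans xq).
rewrite -[in X in (_ - X)%E]AB -measureD; [|exact: measurable_le_EFin|exact: mq|].
  congr (N _); apply/seteqP; split => x /=.
    by move=> [qx xb]; split => //; apply/negP; rewrite -leNgt.
  by move=> [xb /negP]; rewrite -leNgt.
by apply: (le_lt_trans (@probability_le1 _ _ _ N _ (measurable_le_EFin _))); exact: ltry.
Qed.

(** The pivot of a normal variable truncated to [[a, b]], multiplied by the mass of the interval.
    The condition on the ratio means [q <= Phi z], with [q] at the fraction [t] of the way from
    [Phi b] down to [Phi a]. *)
Lemma Phi_pivot (a b : \bar R) (t : R) : 0 <= t <= 1 ->
  N [set z | [/\ (a <= z%:E)%E, (z%:E <= b)%E &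
                 (Phi b - Phi z%:E) / (Phi b - Phi a) <= t]] =
  (t%:E * N [set z | (a <= z%:E)%E /\ (z%:E <= b)%E])%E.
Proof.
move=> /andP[t0 t1].
(* For [b <= a] at most one real point lies in the interval, so both sides are 0, whatever the value
   of the quotient. *)
have [ab|ba] := ltP a b; last first.
  have null (A : set R) : A `<=` [set z : R | (a <= z%:E)%E /\ (z%:E <= b)%E] ->
      N A = 0%E.
    move=> Aab.
    have dom := normal_prob_dominates (0 : R) 1.
    have [[z Az]|none] := pselect (exists z : R, A z); last first.
      rewrite (_ : A = set0) ?measure0//.
      by apply/seteqP; split => // x /= h; apply: none; exists x.
    rewrite (_ : A = [set z]).
      have /null_content_dominatesP := dom.
      by apply => //; exact: lebesgue_measure_set1.
    have [az zb] := Aab _ Az.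
    apply/seteqP; split => x /=; last by move=> ->.
    move=> /Aab[ax xb]; apply/eqP.
    rewrite eq_le -!lee_fin (le_trans xb) ?(le_trans ba)//=.
    by rewrite (le_trans zb)// (le_trans ba).
  by rewrite !null ?mule0// => z [].
have Pab : Phi a < Phi b by exact: Phi_lt.
have d0 : 0 < Phi b - Phi a by rewrite subr_gt0.
have ageE (z : R) : (a <= z%:E)%E = (Phi a <= Phi z%:E).
  apply/idP/idP => [|h]; first exact: Phi_le.
  by rewrite leNgt; apply/negP => /Phi_lt; rewrite ltNge h.
pose q := Phi b - t * (Phi b - Phi a).
have aq : Phi a <= q by rewrite lerBrDr -lerBrDl ler_piMl// ltW.
have qb : q <= Phi b by rewrite lerBlDr lerDl mulr_ge0// ltW.
transitivity (N [set z | q <= Phi z%:E /\ (z%:E <= b)%E]).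
  congr (N _); apply/seteqP; split => z /=.
    move=> [az zb]; rewrite ler_pdivrMr// lerBlDr -lerBlDl => h; split => //.
  move=> [qz zb]; split => //; first by rewrite ageE (le_trans aq).
  by rewrite ler_pdivrMr// lerBlDr -lerBlDl.
rewrite normal_prob_Phi_itv ?qb ?(le_trans (Phi_ge0 _) aq)//.
have -> : [set z | (a <= z%:E)%E /\ (z%:E <= b)%E] =
    [set z | Phi a <= Phi z%:E /\ (z%:E <= b)%E].
  by apply/seteqP; split => z /=; rewrite ageE.
rewrite normal_prob_Phi_itv ?Phi_ge0 ?(ltW Pab)// -EFinM.
by rewrite /q opprB addrC subrK.
Qed.

End Phi.

(** * Polyhedral selection as truncation along the contrast *)

Section truncation.
Context {R : realType} {m n : nat}.
Variables (Q : 'M[R]_(m, n)) (v : 'cV[R]_n).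
Hypothesis v1 : dotp v v = 1.
Implicit Type y : 'cV[R]_n.

(* The endpoints a and b, using |v| = 1. *)
Definition trunc_lo y : \bar R := ((dotp v y)%:E -
  \big[mine/+oo]_(i < m | (0 < (Q *m v) i 0)%R) ((Q *m y) i 0 / (Q *m v) i 0)%:E)%E.

Definition trunc_hi y : \bar R := ((dotp v y)%:E -
  \big[maxe/-oo]_(i < m | ((Q *m v) i 0 < 0)%R) ((Q *m y) i 0 / (Q *m v) i 0)%:E)%E.

Lemma dotpD (u : 'cV[R]_n) y y' : dotp u (y + y') = dotp u y + dotp u y'.
Proof. by rewrite /dotp mulmxDr mxE. Qed.

Lemma dotpZ (u : 'cV[R]_n) a y : dotp u (a *: y) = a * dotp u y.
Proof. by rewrite /dotp -scalemxAr mxE. Qed.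

Lemma TG_trunc y (sigma mu : R) :
  let F x := Phi ((x - mu%:E) * (sigma^-1)%:E)%E in
  TG Q y v sigma mu =
  (F (trunc_hi y) - F (dotp v y)%:E) / (F (trunc_hi y) - F (trunc_lo y)).
Proof.
have l1 : l2norm v = 1 by rewrite /l2norm v1 sqrtr1.
rewrite /TG /trunc_hi /trunc_lo l1 mulr1.
by rewrite (_ : _ *: (Q *m v) = Q *m v)// expr1n invr1 scale1r.
Qed.

Lemma mulmx_shift y r i : (Q *m (y + r *: v)) i 0 = (Q *m y) i 0 + r * (Q *m v) i 0.
Proof. by rewrite mulmxDr -scalemxAr !mxE. Qed.

Let addEK (a b : R) (x : \bar R) : ((a + b)%:E - (x + b%:E) = a%:E - x)%E.
Proof.
by case: x => [x| |]//=; rewrite -!EFinD -?EFinB//; congr (_%:E); ring.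
Qed.

(** The shift adds [r] both to [dotp v y] and to every ratio in the minimum, hence cancels in the
    difference, also when the minimum is infinite. *)
Lemma trunc_lo_shift y r : trunc_lo (y + r *: v) = trunc_lo y.
Proof.
rewrite /trunc_lo dotpD dotpZ v1 mulr1 -[RHS](addEK _ r); congr (_ - _)%E.
rewrite (big_morph (fun x => x + r%:E)%E (id1 := +oo%E) (op1 := mine)); last 2 first.
- by move=> x y'; rewrite /Order.min lteD2rE//; case: ifP.
- by [].
apply: eq_bigr => i w0; rewrite mulmx_shift mulrDl mulfK ?gt_eqF//.
Qed.

Lemma trunc_hi_shift y r : trunc_hi (y + r *: v) = trunc_hi y.
Proof.
rewrite /trunc_hi dotpD dotpZ v1 mulr1 -[RHS](addEK _ r); congr (_ - _)%E.
rewrite (big_morph (fun x => x + r%:E)%E (id1 := -oo%E) (op1 := maxe)); last 2 first.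
- by move=> x y'; exact: adde_maxl.
- by [].
apply: eq_bigr => i w0; rewrite mulmx_shift mulrDl mulfK ?lt_eqF//.
Qed.

(** A row with positive entry in [Q *m v] bounds [dotp v y] from below, one with negative entry from
    above, and one with zero entry puts no bound on it. Relative to [dotp v y], the endpoint
    conditions are just the signs of the extremal ratios. *)
Lemma polyhedron_trunc y :
  (forall i, 0 <= (Q *m y) i 0) <->
  [/\ forall i, (Q *m v) i 0 = 0 -> 0 <= (Q *m y) i 0,
      (trunc_lo y <= (dotp v y)%:E)%E & ((dotp v y)%:E <= trunc_hi y)%E].
Proof.
have lo (a : R) x : (a%:E - x <= a%:E)%E = (0 <= x)%E.
  by case: x => [x| |]//=; rewrite -?EFinB ?lee_fin ?gerBl// leNye leey.
have hi (a : R) x : (a%:E <= a%:E - x)%E = (x <= 0)%E.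
  by case: x => [x| |]//=; rewrite -?EFinB ?lee_fin ?lerBrDr ?gerDl// leNye leey.
rewrite /trunc_lo /trunc_hi lo hi.
split=> [h|[h0 /bigmin_geP[_ h1] /bigmax_leP[_ h2] i]].
  split=> //; [apply/bigmin_geP|apply/bigmax_leP]; split=> // i w0; rewrite lee_fin.
    by rewrite divr_ge0// ltW.
  by rewrite -oppr_ge0 -mulrN -invrN divr_ge0// oppr_ge0 ltW.
have [w0|w0|/h0//] := ltgtP ((Q *m v) i 0) 0.
  have := h2 i w0; rewrite lee_fin -oppr_ge0 -mulrN -invrN.
  by rewrite pmulr_lge0// invr_gt0 oppr_gt0.
by have := h1 i w0; rewrite lee_fin pmulr_lge0// invr_gt0.
Qed.

End truncation.

(** * Measurability of the truncated Gaussian statistic *)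

Section measurability.
Context {R : realType} {d} {T : measurableType d} {n : nat}.
Variable Y : T -> 'cV[R]_n.
Hypothesis mY : forall i, measurable_fun setT (fun w => Y w i 0).

Lemma measurable_mulmx m (Q : 'M[R]_(m, n)) i :
  measurable_fun setT (fun w => (Q *m Y w) i 0).
Proof.
apply: (eq_measurable_fun (fun w => \sum_k Q i k * Y w k 0)) => [w _|].
  by rewrite mxE.
by apply: measurable_sum => k; exact: measurable_funM.
Qed.

(** [Phi x] is the normal mass of the section at [x] of the measurable set of pairs [(x, z)] with
    [z <= x]. *)
Lemma measurable_Phi : measurable_fun setT (@Phi R).
Proof.
have mA : measurable [set p : \bar R * R | (p.2%:E <= p.1)%E].
  rewrite -[X in measurable X]setTI; apply: measurable_lee => //.
  by apply/measurable_EFinP.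
have := measurable_fun_xsection (normal_prob (0 : R) 1) mA.
move=> /(measurableT_comp (fine_measurable measurableT)).
apply: eq_measurable_fun => x _ /=; rewrite /Phi; congr (fine (normal_prob _ _ _)).
by apply/seteqP; split => z; rewrite /xsection /= inE.
Qed.

Lemma measurable_bigmine (I : Type) (r : seq I) (P : pred I) (f : I -> T -> \bar R) :
  (forall i, P i -> measurable_fun setT (f i)) ->
  measurable_fun setT (fun w => \big[mine/+oo]_(i <- r | P i) f i w)%E.
Proof.
move=> mf; elim: r => [|i r IH].
  by apply: (eq_measurable_fun (cst +oo%E)) => // w _; rewrite big_nil.
have [Pi|Pi] := boolP (P i).
  apply: (eq_measurable_fun (fun w => mine (f i w)
    (\big[mine/+oo]_(i <- r | P i) f i w)%E)) => [w _|].
    by rewrite big_cons Pi.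
  by apply: measurable_mine => //; exact: mf.
by apply: eq_measurable_fun IH => w _; rewrite big_cons (negbTE Pi).
Qed.

Lemma measurable_bigmaxe (I : Type) (r : seq I) (P : pred I) (f : I -> T -> \bar R) :
  (forall i, P i -> measurable_fun setT (f i)) ->
  measurable_fun setT (fun w => \big[maxe/-oo]_(i <- r | P i) f i w)%E.
Proof.
move=> mf; elim: r => [|i r IH].
  by apply: (eq_measurable_fun (cst -oo%E)) => // w _; rewrite big_nil.
have [Pi|Pi] := boolP (P i).
  apply: (eq_measurable_fun (fun w => maxe (f i w)
    (\big[maxe/-oo]_(i <- r | P i) f i w)%E)) => [w _|].
    by rewrite big_cons Pi.
  by apply: measurable_maxe => //; exact: mf.
by apply: eq_measurable_fun IH => w _; rewrite big_cons (negbTE Pi).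
Qed.

(** Writing the inverse as [x] times a power of [x ^+ 2] reduces it to power functions; at 0 both
    sides are 0 by convention. *)
Lemma measurable_invr : measurable_fun setT (fun x : R => x^-1).
Proof.
apply: (eq_measurable_fun (fun x : R => x * (x ^+ 2) `^ (-1))) => [x _|].
  rewrite powR_inv1 ?sqr_ge0//; have [->|x0] := eqVneq x 0.
    by rewrite mul0r invr0.
  by field.
apply: measurable_funM => //.
exact: (measurableT_comp (measurable_powR (-1)) (exprn_measurable 2)).
Qed.

Lemma measurable_TG m (Q : 'M[R]_(m, n)) (v : 'cV[R]_n) (sigma mu : R) :
  measurable_fun setT (fun w => TG Q (Y w) v sigma mu).
Proof.
have mv : measurable_fun setT (fun w => (dotp v (Y w))%:E).
  by apply/measurable_EFinP; exact: measurable_mulmx.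
pose c := (sigma * l2norm v)^-1.
have mF (g : T -> \bar R) : measurable_fun setT g ->
    measurable_fun setT (fun w => Phi ((g w - mu%:E) * c%:E)%E).
  move=> mg; apply: (measurableT_comp measurable_Phi).
  by apply: emeasurable_funM => //; exact: emeasurable_funB.
have mr i : measurable_fun setT (fun w =>
    ((Q *m Y w) i 0 / (l2norm v ^- 2 *: (Q *m v)) i 0)%:E).
  by apply/measurable_EFinP/measurable_funM => //; exact: measurable_mulmx.
have mhi := mF _ (emeasurable_funB mv (measurable_bigmaxe (index_enum _)
  (P := fun i => (l2norm v ^- 2 *: (Q *m v)) i 0 < 0) (fun i _ => mr i))).
have mlo := mF _ (emeasurable_funB mv (measurable_bigmine (index_enum _)
  (P := fun i => 0 < (l2norm v ^- 2 *: (Q *m v)) i 0) (fun i _ => mr i))).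
rewrite /TG; apply: measurable_funM; first by apply: measurable_funB => //; exact: mF.
apply: (measurableT_comp measurable_invr); exact: measurable_funB.
Qed.

End measurability.

(** * The pivotal identity for the law of the noise *)

Section normal_scale.
Context {R : realType} (s : R) (s0 : 0 < s).

Lemma normal_prob_scale (C : set R) : measurable C ->
  normal_prob 0 s C = normal_prob 0 1 ((fun z => s * z) @^-1` C).
Proof.
move=> mC; have sN0 : s != 0 by rewrite gt_eqF.
have mC' : measurable ((fun z => s * z) @^-1` C).
  by rewrite -[X in measurable X]setTI; exact: mulrl_measurable.
have indic (u : R) (A : set R) : measurable A ->
    (normal_prob 0 u A =
     \int[lebesgue_measure]_x ((\1_A x)%:E * (normal_pdf 0 u x)%:E))%E.
  move=> mA; rewrite -ge0_integral_normal_prob//; last first.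
    by apply/measurable_EFinP; exact: measurable_indic.
  by rewrite integral_indic// setIT.
pose G x := ((\1_C x)%:E * (normal_pdf 0 s x)%:E)%E.
have mG : measurable_fun setT G.
  by apply: emeasurable_funM; apply/measurable_EFinP;
    [exact: measurable_indic|exact: measurable_normal_pdf].
have G0 x : (0 <= G x)%E by rewrite mule_ge0// lee_fin normal_pdf_ge0.
transitivity (\int[lebesgue_measure]_x G x)%E; first exact: indic.
transitivity (`|s|%:E * \int[lebesgue_measure]_z G (s * z + 0)%R)%E.
  exact: ge0_integral_affine.
transitivity (\int[lebesgue_measure]_z (`|s|%:E * G (s * z + 0)%R))%E.
  apply/esym/ge0_integralZl => //.
  exact: (measurableT_comp mG (measurable_affine s 0)).
apply: etrans (esym (indic _ _ mC')); apply: eq_integral => z _.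
rewrite /G addr0 muleCA gtr0_norm//; congr (_ * _)%E.
rewrite -EFinM !normal_pdfE ?oner_neq0//; congr (_%:E).
rewrite /normal_peak /normal_fun !subr0 mulrA expr1n mul1r -mulrnAr.
rewrite sqrtrM ?sqr_ge0// sqrtr_sqr gtr0_norm// invfM mulrA divff// mul1r.
congr (_ * expR _); rewrite exprMn -mulr_natr.
by field.
Qed.

End normal_scale.

Section TG_pivot.
Context {R : realType} {m n : nat}.
Variables (Q : 'M[R]_(m, n)) (v theta : 'cV[R]_n) (sigma : R).
Hypotheses (v1 : dotp v v = 1) (s0 : 0 < sigma).
Variable nu : probability (n.-tuple R) R.
Hypothesis nuE : forall B : 'I_n -> set R, (forall i, measurable (B i)) ->
  (nu (box B) = \prod_(i < n) normal_prob 0%R sigma (B i))%E.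

Let obs (y : n.-tuple R) : 'cV[R]_n := \col_i (theta i 0 + tnth y i).
Let mu := dotp v theta.
Let S := [set y | forall i, 0 <= (Q *m obs y) i 0].

Let mobs i : measurable_fun setT (fun y => obs y i 0).
Proof.
apply: (eq_measurable_fun (fun y => theta i 0 + tnth y i)) => [y _|].
  by rewrite mxE.
by apply: measurable_funD => //; exact: measurable_tnth.
Qed.

Lemma measurable_polyhedron : measurable S.
Proof.
rewrite (_ : S = \bigcap_(i in [set: 'I_m]) [set y | 0 <= (Q *m obs y) i 0]).
  apply: fin_bigcap_measurable => // i _.
  have := measurable_mulmx mobs Q i measurableT (measurable_itv `[0, +oo[).
  by rewrite setTI; congr measurable; apply/seteqP; split => y /=; rewrite in_itv/= andbT.
by apply/seteqP; split => y h; [move=> i _; exact: h|move=> i; exact: h].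
Qed.

Lemma measurable_TG_le t : measurable [set y | TG Q (obs y) v sigma mu <= t].
Proof.
have := measurable_TG mobs Q v sigma mu measurableT (measurable_itv `]-oo, t]).
by rewrite setTI; congr measurable; apply/seteqP; split => y /=; rewrite in_itv.
Qed.

(** Only the noise is redrawn, so the new coordinate of the observation along [v] is [mu + x],
    whatever [y] was. *)
Let obs_resample y x :
  obs (resample (fun i => v i 0) y x) = obs y + (mu + x - dotp v (obs y)) *: v.
Proof.
have -> : dotp v (obs y) = mu + \sum_k v k 0 * tnth y k.
  rewrite /dotp /mu /dotp !mxE -big_split; apply: eq_bigr => k _.
  by rewrite !mxE mulrDr.
by apply/colP => i; rewrite !mxE tnth_mktuple; ring.
Qed.

(** By resampling along [v], the mass of a set is the mean normal mass of its fibres. On each fibre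
    the endpoints are constant and the selection event is an interval or empty, so [Phi_pivot]
    applies fibrewise. The product form involves no division by [nu S]. *)
Lemma TG_pivot t : 0 <= t <= 1 ->
  nu (S `&` [set y | TG Q (obs y) v sigma mu <= t]) = (t%:E * nu S)%E.
Proof.
move=> t01; have mS := measurable_polyhedron; have mTG := measurable_TG_le t.
have sN0 : sigma != 0 by rewrite gt_eqF.
have vsum : \sum_k v k 0 ^+ 2 = 1.
  by rewrite -v1 /dotp mxE; apply: eq_bigr => k _; rewrite mxE expr2.
have mres y : measurable_fun setT (resample (fun i => v i 0) y).
  exact: (measurableT_comp (measurable_resample _) (pair1_measurable y)).
pose res y := resample (fun i => v i 0) y.
have mT (A : set (n.-tuple R)) y : measurable A -> measurable (res y @^-1` A).
  by move=> mA; rewrite -[X in measurable X]setTI; exact: mres.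
have nuI (A : set (n.-tuple R)) : measurable A ->
    (nu A = \int[nu]_y normal_prob 0%R sigma (res y @^-1` A))%E.
  move=> mA.
  have mI : measurable_fun setT (fun y => (\1_A y)%:E : \bar R).
    by apply/measurable_EFinP; exact: measurable_indic.
  transitivity (\int[nu]_y (\1_A y)%:E)%E; first by rewrite integral_indic// setIT.
  apply: etrans (resamplable_unit sN0 nuE vsum mI _) _ => //; apply: eq_integral => y _.
  have := integral_indic (normal_prob 0%R sigma) measurableT (mT A y mA).
  by rewrite setIT => <-.
transitivity (\int[nu]_y (t%:E * normal_prob 0%R sigma (res y @^-1` S)))%E; last first.
  rewrite [in RHS](nuI _ mS); apply: ge0_integralZl => //.
  - have mI : measurable_fun setT (fun y => (\1_S y)%:E : \bar R).
      by apply/measurable_EFinP; exact: measurable_indic.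
    have mint := @measurable_resample_integral _ sigma _ (fun i => v i 0) _ mI.
    apply: eq_measurable_fun (mint _) => // y _.
    have := integral_indic (normal_prob 0%R sigma) measurableT (mT S y mS).
    by rewrite setIT => <-.
  - by case/andP: t01.
rewrite (nuI _ (measurableI _ _ mS mTG)).
apply: eq_integral => y _.
(* The redrawn coordinate is written [sigma * z] with [z] standard normal, to match the
   normalization inside [Phi]. *)
rewrite (normal_prob_scale s0 (mT _ y (measurableI _ _ mS mTG))).
rewrite (normal_prob_scale s0 (mT _ y mS)).
pose lo := ((trunc_lo Q v (obs y) - mu%:E) * (sigma^-1)%:E)%E.
pose hi := ((trunc_hi Q v (obs y) - mu%:E) * (sigma^-1)%:E)%E.
(* The constraints orthogonal to [v] are the same along the whole fibre; where they fail, both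
   fibres are empty. *)
pose H := forall i, (Q *m v) i 0 = 0 -> 0 <= (Q *m obs y) i 0.
have vres z : dotp v (obs (res y (sigma * z))) = mu + sigma * z.
  by rewrite obs_resample dotpD dotpZ v1 mulr1 addrC subrK.
have SE z : S (res y (sigma * z)) <-> [/\ H, (lo <= z%:E)%E & (z%:E <= hi)%E].
  have PE := polyhedron_trunc Q v (obs (res y (sigma * z))).
  apply: (iff_trans PE) => {PE}.
  rewrite vres obs_resample trunc_lo_shift// trunc_hi_shift//.
  have -> : (lo <= z%:E)%E = (trunc_lo Q v (obs y) <= (mu + sigma * z)%:E)%E.
    by rewrite /lo lee_pdivrMr// leeBlDr// -EFinM -EFinD mulrC addrC.
  have -> : (z%:E <= hi)%E = ((mu + sigma * z)%:E <= trunc_hi Q v (obs y))%E.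
    by rewrite /hi lee_pdivlMr// leeBrDr// -EFinM -EFinD mulrC addrC.
  suff -> : (forall i, (Q *m v) i 0 = 0 ->
      0 <= (Q *m (obs y + (mu + sigma * z - dotp v (obs y)) *: v)) i 0) = H by [].
  apply/propext; split => h i w0; have := h i w0;
    by rewrite mulmx_shift w0 mulr0 addr0.
have TGE z : TG Q (obs (res y (sigma * z))) v sigma mu =
    (Phi hi - Phi z%:E) / (Phi hi - Phi lo).
  have ze : (((dotp v (obs (res y (sigma * z))))%:E - mu%:E) * (sigma^-1)%:E = z%:E)%E.
    by rewrite vres -EFinB -EFinM addrC addKr mulrAC mulfV// mul1r.
  have loe : trunc_lo Q v (obs (res y (sigma * z))) = trunc_lo Q v (obs y).
    by rewrite obs_resample trunc_lo_shift.
  have hie : trunc_hi Q v (obs (res y (sigma * z))) = trunc_hi Q v (obs y).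
    by rewrite obs_resample trunc_hi_shift.
  have := TG_trunc Q v1 (obs (res y (sigma * z))) sigma mu.
  by cbv zeta; rewrite loe hie ze.
have [h|nh] := pselect H; last first.
  rewrite (_ : _ @^-1` _ = set0).
    rewrite (_ : [eta _] @^-1` _ = set0) ?measure0 ?mule0//.
    by apply/seteqP; split => // z /SE[].
  by apply/seteqP; split => // z [/SE[]].
rewrite (_ : _ @^-1` _ = [set z | [/\ (lo <= z%:E)%E, (z%:E <= hi)%E &
  (Phi hi - Phi z%:E) / (Phi hi - Phi lo) <= t]]).
  rewrite (Phi_pivot _ _ t01); congr (_ * normal_prob _ _ _)%E.
  by apply/seteqP; split => z; [move=> [zl zh]; apply/SE|move/SE => []].
apply/seteqP; split => z /=.
  by move=> [/SE[_ zl zh]]; rewrite TGE.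
by move=> [zl zh]; rewrite -TGE => zt; split => //; apply/SE.
Qed.

End TG_pivot.

(** * Mean of the normal law and laws of Gaussian samples *)

Section normal_mean.
Context {R : realType} (s : R) (s0 : 0 < s).
Local Notation N := (normal_prob 0 s).
Notation mu := (@lebesgue_measure R).

Let sN0 : s != 0. Proof. by rewrite gt_eqF. Qed.

(* Domination by the normal density of variance 2 s^2 *)
Let bound (x : R) : `|x| * normal_pdf 0 s x <=
  (s * normal_peak s / normal_peak (s * Num.sqrt 2)) *
  normal_pdf 0 (s * Num.sqrt 2) x.
Proof.
have s20 : s * Num.sqrt 2 != 0 by rewrite mulf_neq0// sqrtr_eq0 -ltNge ltr0n.
rewrite !normal_pdfE// /normal_fun !subr0.
rewrite [leRHS](_ : _ = normal_peak s *
  (s * expR (- x ^+ 2 / ((s * Num.sqrt 2) ^+ 2 *+ 2)))); last first.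
  by field; rewrite gt_eqF// normal_peak_gt0.
rewrite mulrCA ler_wpM2l ?normal_peak_ge0//.
rewrite exprMn sqr_sqrtr ?ler0n//.
pose u := x ^+ 2 / (s ^+ 2 *+ 4).
have -> : - x ^+ 2 / (s ^+ 2 *+ 2) = - u + - u.
  by rewrite /u; field.
have -> : - x ^+ 2 / (s ^+ 2 * 2 *+ 2) = - u.
  by rewrite /u; field.
rewrite expRD mulrA ler_wpM2r ?expR_ge0//.
rewrite expRN ler_pdivrMr ?expR_gt0//.
apply: (@le_trans _ _ (s * (1 + u))); last by rewrite ler_wpM2l ?(ltW s0)// expR_ge1Dx.
(* AM-GM: |x| <= s (1 + x^2 / (4 s^2)) *)
have -> : s * (1 + u) = `|x| + s * (1 - `|x| / (s *+ 2)) ^+ 2.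
  rewrite /u -[x ^+ 2]real_normK ?num_real//; field.
  by [].
by rewrite lerDl mulr_ge0 ?(ltW s0)// sqr_ge0.
Qed.

Lemma normal_prob_integrable : N.-integrable setT (fun x : R => x%:E).
Proof.
apply/integrableP; split; first by apply/measurable_EFinP.
pose C := s * normal_peak s / normal_peak (s * Num.sqrt 2).
have mn : measurable_fun setT (fun x : R => `|x%:E|%E).
  by apply: measurableT_comp => //; apply/measurable_EFinP.
apply: (@le_lt_trans _ _ (\int[mu]_x (C%:E * (normal_pdf 0 (s * Num.sqrt 2) x)%:E))%E).
  rewrite (ge0_integral_normal_prob 0 s mn)//.
  apply: ge0_le_integral => //.
  - by move=> x _; rewrite mule_ge0// lee_fin normal_pdf_ge0.
  - by apply: emeasurable_funM => //; apply/measurable_EFinP; exact: measurable_normal_pdf.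
  - by apply: emeasurable_funM => //; apply/measurable_EFinP; exact: measurable_normal_pdf.
  - by move=> x _; rewrite abse_EFin -!EFinM lee_fin; exact: bound.
rewrite integralZl//; last exact: integrable_normal_pdf.
by rewrite integral_normal_pdf mule1 ltry.
Qed.

(** By symmetry the positive and negative parts have equal integrals, and integrability makes these
    finite, so that the difference is 0. *)
Lemma normal_prob_mean : (\int[N]_x x%:E = 0)%E.
Proof.
have /integrableP[_ fin] := normal_prob_integrable.
pose f (x : R) : \bar R := x%:E.
have mf : measurable_fun setT f by apply/measurable_EFinP.
rewrite -[LHS]/(\int[N]_x f x)%E integralE.
have -> : (\int[N]_x f^\- x = \int[N]_x f^\+ x)%E.
  apply: etrans _ (ge0_integral_normal_probN sN0 (measurable_funepos mf) _) => //.
  by apply: eq_integral => x _; rewrite funeposE funenegE /f EFinN.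
rewrite subee// ge0_fin_numE; last by apply: integral_ge0.
apply: le_lt_trans fin; apply: ge0_le_integral => //.
- exact: measurable_funepos.
- exact: measurableT_comp.
- by move=> x _; rewrite funeposE ge_max lee_abs abse_ge0.
Qed.

End normal_mean.

Section gaussian_sample.
Context {dT : measure_display} {T : measurableType dT} {R : realType}.
Variables (P : probability T R) (s : R).
Hypothesis s0 : 0 < s.

Lemma ge0_integral_gaussian (Z : {RV P >-> R}) (f : R -> \bar R) : gaussian s Z ->
  measurable_fun setT f -> (forall x, 0 <= f x)%E ->
  (\int[P]_w f (Z w) = \int[normal_prob 0%R s]_x f x)%E.
Proof.
move=> gZ mf f0.
have mZ : measurable_fun setT (Z : T -> measurableTypeR R).
  by move=> mT A mA; apply: (@measurable_funP _ _ _ _ setT Z mT A).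
pose m (_ : measurable_fun setT (Z : T -> measurableTypeR R)) :=
  pushforward P (Z : T -> measurableTypeR R).
transitivity (\int[m mZ]_x f x)%E.
  by rewrite ge0_integral_pushforward.
by apply: eq_measure_integral => A mA _; exact: gZ.
Qed.

(** Makes the formula for the mean of [Omega] available for normal errors, which are given by their
    law alone. *)
Lemma gaussian_mean_zero (Z : {RV P >-> R}) : gaussian s Z -> mean_zero Z.
Proof.
move=> gZ; pose f (x : R) : \bar R := x%:E.
have mf : measurable_fun setT f by apply/measurable_EFinP.
have /integrableP[_ fin] := normal_prob_integrable s0.
have iZ : P.-integrable setT (EFin \o Z).
  apply/integrableP; split; first by apply/measurable_EFinP.
  rewrite (ge0_integral_gaussian gZ (f := fun x => `|x%:E|%E))//.
  exact: (measurableT_comp (@abse_measurable R setT) mf).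
split=> //.
rewrite expectation_def -(normal_prob_mean s0) -[LHS]/(\int[P]_w (f \o Z) w)%E.
rewrite integralE -[RHS]/(\int[normal_prob 0%R s]_x f x)%E [RHS]integralE; congr (_ - _)%E.
  rewrite funepos_comp; apply: ge0_integral_gaussian => //; exact: measurable_funepos.
rewrite funeneg_comp; apply: ge0_integral_gaussian => //; exact: measurable_funeneg.
Qed.

Variables (n : nat) (eps : 'I_n -> {RV P >-> R}).

Definition sample (w : T) : n.-tuple R := [tuple eps i w | i < n].

Lemma measurable_sample : measurable_fun setT sample.
Proof.
apply/measurable_fun_tnthP => i.
by apply: (eq_measurable_fun (eps i)) => // w _ /=; rewrite tnth_mktuple.
Qed.

HB.instance Definition _ := isMeasurableFun.Build _ _ _ _ sample measurable_sample.

Definition sample_law : probability (n.-tuple R) R := distribution P sample.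

Lemma sample_lawE : iid eps -> (forall i, gaussian s (eps i)) ->
  forall B : 'I_n -> set R, (forall i, measurable (B i)) ->
  (sample_law (box B) = \prod_(i < n) normal_prob 0%R s (B i))%E.
Proof.
move=> [ind _] g B mB.
rewrite -[LHS]/(P (sample @^-1` box B)).
transitivity (P (\bigcap_(i in [set: 'I_n]) (eps i @^-1` B i))).
  congr (P _); apply/seteqP; split => w /= h.
    by move=> i _; have := h i; rewrite tnth_mktuple.
  by move=> i; rewrite tnth_mktuple; exact: h.
by rewrite ind//; apply: eq_bigr => i _; exact: (g i _ (mB i)).
Qed.

End gaussian_sample.

(** * Designs with proportional moment matrices *)

Section same_moments.
Context {R : realType} {d n n' : nat}.
Variables (X : 'M[R]_(n, d)) (X' : 'M[R]_(n', d)) (q : R).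
Hypothesis q0 : 0 < q.
Hypothesis XX : X'^T *m X' = q ^- 2 *: (X^T *m X).

(* W and W' have the same coefficients on the columns of X and X', up to the factor g. *)
Definition copy (g : R) m (W : 'M[R]_(n, m)) (W' : 'M[R]_(n', m)) :=
  exists C : 'M[R]_(d, m), W = X *m C /\ W' = g *: (X' *m C).

Lemma copy_mulr g m l (W : 'M[R]_(n, m)) W' (K : 'M[R]_(m, l)) :
  copy g W W' -> copy g (W *m K) (W' *m K).
Proof.
by move=> [C [-> ->]]; exists (C *m K); rewrite mulmxA -scalemxAl mulmxA.
Qed.

Lemma copyB g m (W V : 'M[R]_(n, m)) W' V' :
  copy g W W' -> copy g V V' -> copy g (W - V) (W' - V').
Proof.
move=> [C [-> ->]] [D [-> ->]]; exists (C - D).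
by rewrite !mulmxBr scalerBr.
Qed.

Lemma copyZ g (a b : R) m (W : 'M[R]_(n, m)) W' : copy g W W' ->
  copy (g * b) (a *: W) ((b * a) *: W').
Proof.
move=> [C [-> ->]]; exists (a *: C); rewrite -!scalemxAr !scalerA; split => //.
by congr (_ *: _); ring.
Qed.

Lemma copy_tr g h m l (W : 'M[R]_(n, m)) W' (V : 'M[R]_(n, l)) V' :
  copy g W W' -> copy h V V' -> W'^T *m V' = (g * h / q ^+ 2) *: (W^T *m V).
Proof.
move=> [C [-> ->]] [D [-> ->]].
rewrite [(g *: _)^T]linearZ /= -scalemxAl -scalemxAr scalerA !trmx_mul.
rewrite -2!mulmxA (mulmxA X'^T) XX -scalemxAl -scalemxAr scalerA.
by rewrite -!mulmxA.
Qed.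

Lemma copy_tr1 m l (W : 'M[R]_(n, m)) W' (V : 'M[R]_(n, l)) V' :
  copy 1 W W' -> copy 1 V V' -> W'^T *m V' = q ^- 2 *: (W^T *m V).
Proof. by move=> hW hV; rewrite (copy_tr hW hV) !mul1r. Qed.

Lemma copy_cols A : copy 1 (cols X A) (cols X' A).
Proof. by exists (cols 1%:M A); rewrite scale1r /cols !mulmx_colsub !mulmx1. Qed.

Lemma copy_col j : copy 1 (col j X) (col j X').
Proof. by exists (delta_mx j 0); rewrite scale1r -!colE. Qed.

Let q2 : q ^+ 2 != 0. Proof. by rewrite expf_neq0 ?gt_eqF. Qed.

Lemma copy_gram A : gram X' A = q ^- 2 *: gram X A.
Proof. by rewrite /gram (copy_tr1 (copy_cols A) (copy_cols A)). Qed.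

Lemma copy_gram_unit A : (gram X' A \in unitmx) = (gram X A \in unitmx).
Proof. by rewrite copy_gram unitmxZ// unitfE invr_eq0. Qed.

Lemma copy_invgram A : gram X A \in unitmx ->
  invmx (gram X' A) = q ^+ 2 *: invmx (gram X A).
Proof. by move=> uA; rewrite copy_gram invmxZ ?invrK// -copy_gram copy_gram_unit. Qed.

Lemma copy_basis A (e : 'cV[R]_(size A)) : gram X A \in unitmx ->
  copy (q ^+ 2) (cols X A *m invmx (gram X A) *m e) (cols X' A *m invmx (gram X' A) *m e).
Proof.
move=> uA; rewrite copy_invgram// -!scalemxAr -!scalemxAl.
have := copyZ 1 (q ^+ 2) (copy_mulr (invmx (gram X A) *m e) (copy_cols A)).
by rewrite mul1r mulr1 scale1r !mulmxA.
Qed.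

(** In the projection the factor [q ^- 2] of the cross products cancels the factor [q ^+ 2] of the
    inverse Gram matrix. *)
Lemma copy_Pperp A j : gram X A \in unitmx ->
  copy 1 (Pperp X A *m col j X) (Pperp X' A *m col j X').
Proof.
move=> uA; rewrite /Pperp /lscoef !mulmxBl !mul1mx; apply: copyB.
  exact: copy_col.
rewrite -!mulmxA (copy_tr1 (copy_cols A) (copy_col j)) copy_invgram//.
rewrite -!scalemxAl -!scalemxAr !scalerA mulfV// scale1r.
exact: copy_mulr (copy_cols A).
Qed.

(** The factor is positive so that inequalities keep their direction. It may differ from row to row,
    since rows matter only up to positive scaling. *)
Definition copy_row (r : 'rV[R]_n) (r' : 'rV[R]_n') :=
  exists2 g, 0 < g & copy g r^T r'^T.

Lemma copy_rowZ g (a b : R) r r' : 0 < g -> 0 < b -> copy g r^T r'^T ->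
  copy_row (a *: r) ((b * a) *: r').
Proof.
move=> g0 b0 rr; exists (g * b); first exact: mulr_gt0.
by rewrite !linearZ; exact: copyZ.
Qed.

Lemma copy_lscoef A i : gram X A \in unitmx ->
  copy (q ^+ 2) (row i (lscoef X A))^T (row i (lscoef X' A))^T.
Proof.
move=> uA; rewrite !tr_row !colE /lscoef !trmx_mul !trmxK copy_invgram// linearZ /=.
rewrite -!scalemxAr -!scalemxAl -!mulmxA.
have := copyZ 1 (q ^+ 2)
  (copy_mulr ((invmx (gram X A))^T *m delta_mx i (0 : 'I_1)) (copy_cols A)).
by rewrite mul1r mulr1 scale1r.
Qed.

Lemma copy_sign_rows A s : gram X A \in unitmx ->
  List.Forall2 copy_row (sign_rows X A s) (sign_rows X' A s).
Proof.
move=> uA; rewrite /sign_rows /image_mem.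
elim: (enum _) => [|i l IH] /=; constructor => //.
have := @copy_rowZ (q ^+ 2) ((-1) ^+ nth false s i) 1 _ _ _ _ (copy_lscoef i uA).
by rewrite mul1r; apply; rewrite ?exprn_gt0.
Qed.

Lemma dotp_ge0 m (u : 'cV[R]_m) : 0 <= dotp u u.
Proof. by rewrite /dotp mxE sumr_ge0// => i _; rewrite mxE -expr2 sqr_ge0. Qed.

Lemma dotp_eq0 m (u : 'cV[R]_m) : (dotp u u == 0) = (u == 0).
Proof.
apply/eqP/eqP => [|->]; last by rewrite /dotp mulmx0 mxE.
rewrite /dotp mxE => /eqP; rewrite psumr_eq0 => [|k _]; last first.
  by rewrite mxE -expr2 sqr_ge0.
move=> /allP h; apply/colP => i; apply/eqP; rewrite mxE -sqrf_eq0.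
by have := h i (mem_index_enum _); rewrite mxE -expr2.
Qed.

Lemma l2norm2 m (u : 'cV[R]_m) : l2norm u ^+ 2 = dotp u u.
Proof. by rewrite sqr_sqrtr// dotp_ge0. Qed.

Lemma copy_fs_vec A j : gram X A \in unitmx ->
  copy (q ^+ 2) (fs_vec X A j)^T (fs_vec X' A j)^T.
Proof.
move=> uA; have cP := copy_Pperp j uA.
rewrite /fs_vec !linearZ /= !l2norm2.
have -> : dotp (Pperp X' A *m col j X') (Pperp X' A *m col j X') =
    q ^- 2 * dotp (Pperp X A *m col j X) (Pperp X A *m col j X).
  by rewrite /dotp (copy_tr1 cP cP) mxE.
rewrite invfM invrK -[q ^+ 2 in X in copy X]mul1r; apply: copyZ.
rewrite !trmx_mul !trmxK /Pperp /lscoef !linearB /= !trmx1 !mulmxBl !mul1mx.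
apply: copyB; first exact: copy_col.
rewrite !trmx_mul !trmxK -!mulmxA (copy_tr1 (copy_cols A) (copy_col j)) copy_invgram//.
rewrite [(_ *: _)^T]linearZ /= -!scalemxAl -!scalemxAr !scalerA mulfV// scale1r.
exact: copy_mulr (copy_cols A).
Qed.

(** All vectors compared in one step carry the same factor [q ^+ 2], so their signed differences are
    copied too. *)
Lemma copy_fs_rows A A' s : gram X A \in unitmx -> gram X A' \in unitmx ->
  List.Forall2 copy_row (fs_rows X (A, (A', s))) (fs_rows X' (A, (A', s))).
Proof.
move=> uA uA'; apply: List.Forall2_app; first exact: copy_sign_rows.
rewrite /image_mem; elim: (enum _) => [|t l IH] /=; constructor => //.
exists (q ^+ 2); first by rewrite exprn_gt0.
have trB m (a b : R) (u w : 'rV[R]_m) : (a *: u - b *: w)^T = a *: u^T - b *: w^T.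
  by rewrite linearB !linearZ.
rewrite !trB; apply: copyB.
  have := copyZ ((-1) ^+ last false s) 1 (copy_fs_vec t.1.1 uA).
  by rewrite mulr1 mul1r.
have := copyZ ((-1) ^+ t.2) 1 (copy_fs_vec t.1.2 uA).
by rewrite mulr1 mul1r.
Qed.

Lemma copy_fs M A : gram X A \in unitmx ->
  (forall x, x \in zip (A :: unzip1 M) M -> fs_regular X x) ->
  List.Forall2 copy_row (flatten [seq fs_rows X x | x <- zip (A :: unzip1 M) M])
                        (flatten [seq fs_rows X' x | x <- zip (A :: unzip1 M) M]).
Proof.
elim: M A => [|[A' s] M IH] A uA reg; first by constructor.
have [uA' _] : fs_regular X (A, (A', s)) by apply: reg; rewrite mem_head.
apply: List.Forall2_app; first exact: copy_fs_rows.
by apply: IH => // x xM; apply: reg; rewrite inE xM orbT.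
Qed.

Lemma copy_cden (st : @state d) c : gram X (unzip1 st) \in unitmx ->
  cden X' st c = (if c is inl _ then 1 else q ^+ 2) * cden X st c.
Proof.
move=> uA; case: c => [[j b]|j] /=.
  rewrite mul1r (copy_tr1 (copy_col j) (copy_cols _)) copy_invgram//.
  by rewrite -!scalemxAr -!scalemxAl scalerA mulfV// scale1r.
by rewrite copy_invgram// -scalemxAr -scalemxAl mxE.
Qed.

(** For a crossing candidate the factor [q ^+ 2] occurs in numerator and denominator. Hence joining
    and crossing candidates, and the knots of different steps, all have factor 1, and their
    differences are copied. *)
Lemma copy_cvec (st : @state d) c : gram X (unzip1 st) \in unitmx ->
  copy 1 (cvec X st c) (cvec X' st c).
Proof.
move=> uA; have := copy_cden c uA; case: c => [[j b]|j] cE; rewrite /cvec cE.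
  rewrite invfM invr1; have := copyZ (cden X st (inl (j, b)))^-1 1 (copy_Pperp j uA).
  by rewrite mulr1.
have := copyZ (cden X st (inr j))^-1 (q ^- 2) (copy_basis (basis_at _ j) uA).
by rewrite mulfV// -[in X in X -> _]invfM.
Qed.

Lemma copy_row1 r r' : copy 1 r r' -> copy_row r^T r'^T.
Proof. by move=> h; exists 1; rewrite ?trmxK. Qed.

(** The previous knot is computed in the state before the preceding step, so the Gram matrix of that
    state must be invertible as well. *)
Definition prev_unit (x : @ctx d) :=
  if x.2 is Some (st, _) then gram X (unzip1 st) \in unitmx else true.

Lemma copy_path_rows b (z : @ctx d * path_step d) :
  gram X (unzip1 z.1.1) \in unitmx -> prev_unit z.1 -> gram X z.2.1.1 \in unitmx ->
  List.Forall2 copy_row (path_rows b X z) (path_rows b X' z).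
Proof.
case: z => -[st prev] [[A' s] [E e]] /= ust up uA'.
apply: List.Forall2_app; first exact: copy_sign_rows.
have diff u u' w w' : copy 1 u u' -> copy 1 w w' -> copy_row (u^T - w^T) (u'^T - w'^T).
  by move=> hu hw; rewrite -!linearB; apply: copy_row1; exact: copyB.
apply: List.Forall2_app.
  case: prev up => [[st0 e0]|] up; last by constructor.
  rewrite /image_mem; elim: (enum _) => [|c l IH] /=; constructor => //.
  by case: ifP => _; apply: diff; exact: copy_cvec.
apply: List.Forall2_app.
  rewrite /image_mem; elim: (enum _) => [|c l IH] /=; constructor => //.
  by apply: diff; exact: copy_cvec.
by constructor; [apply: copy_row1; exact: copy_cvec|constructor].
Qed.

(** [path_ok] identifies the recorded list [A'] with the active list of the updated state;
    regularity at [A'] then provides the invertible Gram matrix for the next step. *)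
Lemma copy_path b y M st prev : gram X (unzip1 st) \in unitmx -> prev_unit (st, prev) ->
  (forall z, z \in path_ctx st prev M -> path_regular b X z) ->
  (forall z, z \in path_ctx st prev M -> path_ok b X y z) ->
  List.Forall2 copy_row (flatten [seq path_rows b X z | z <- path_ctx st prev M])
                        (flatten [seq path_rows b X' z | z <- path_ctx st prev M]).
Proof.
elim: M st prev => [|[[A' s] [E e]] M IH] st prev ust up reg ok; first by constructor.
have [uA' _] : path_regular b X (st, prev, (A', s, (E, e))) by apply: reg; rewrite mem_head.
have [[A'E _] _ _ _ _] : path_ok b X y (st, prev, (A', s, (E, e))).
  by apply: ok; rewrite mem_head.
apply: List.Forall2_app; first exact: copy_path_rows.
apply: IH => //; first by rewrite -A'E.
- by move=> z zM; apply: reg; rewrite inE zM orbT.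
- by move=> z zM; apply: ok; rewrite inE zM orbT.
Qed.

Lemma copy_rows p k (M : model p d k) y : regular X M -> selected X y M ->
  List.Forall2 copy_row (rows X M) (rows X' M).
Proof.
have u0 : gram X [::] \in unitmx by rewrite unitmxE det_mx00 unitr1.
case: p M => M reg sel /=.
- exact: copy_fs.
- exact: (copy_path (st := [::]) (prev := None) u0 isT reg sel).
- exact: (copy_path (st := [::]) (prev := None) u0 isT reg sel).
Qed.

(** The numerator contributes [q ^+ 2] and the normalizing square root [q^-1]. The resulting factor
    [q] is the one for which lengths and products with the response are unchanged. *)
Lemma copy_contrast (A : {set 'I_d}) j : gram X (enum A) \in unitmx ->
  copy q (contrast X A j) (contrast X' A j).
Proof.
move=> uA; rewrite /contrast.
set e := basis_at _ _; set Gi := invmx (gram X _); set Gi' := invmx (gram X' _).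
have -> : (e^T *m Gi' *m e) 0 0 = q ^+ 2 * (e^T *m Gi *m e) 0 0.
  by rewrite /Gi' copy_invgram// -scalemxAr -scalemxAl mxE.
rewrite sqrtrM ?sqr_ge0// sqrtr_sqr gtr0_norm// invfM.
have := copyZ (Num.sqrt ((e^T *m Gi *m e) 0 0))^-1 q^-1 (copy_basis e uA).
by rewrite expr2 -mulrA mulfV ?gt_eqF// mulr1.
Qed.

Variables (y : 'cV[R]_n) (y' : 'cV[R]_n').
Hypothesis Xy : X'^T *m y' = q^-1 *: (X^T *m y).

Lemma copy_dotp g u u' : copy g u u' -> dotp u' y' = g / q * dotp u y.
Proof.
move=> [C [-> ->]]; rewrite /dotp [(g *: _)^T]linearZ /= !trmx_mul -!scalemxAl -!mulmxA Xy.
by rewrite -scalemxAr !mxE mulrA.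
Qed.

Lemma dotp_contrast_copy (A : {set 'I_d}) j : gram X (enum A) \in unitmx ->
  dotp (contrast X' A j) y' = dotp (contrast X A j) y.
Proof.
by move=> uA; rewrite (copy_dotp (copy_contrast j uA)) mulfV ?gt_eqF// mul1r.
Qed.

(** Squared lengths change by the positive factor [g * g / q ^+ 2]. Zero rows are therefore dropped
    at the same positions for both designs. *)
Lemma copy_row_neq0 r r' : copy_row r r' -> (r' != 0) = (r != 0).
Proof.
move=> [g g0 rr].
have nz m (u : 'rV[R]_m) : (u != 0) = (dotp u^T u^T != 0).
  by rewrite dotp_eq0 -(inj_eq trmx_inj) linear0.
rewrite !nz {1}/dotp (copy_tr rr rr) mxE mulf_eq0 negb_or -/(dotp r^T r^T).
have -> // : g * g / q ^+ 2 != 0.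
by rewrite gt_eqF// divr_gt0 ?mulr_gt0 ?exprn_gt0.
Qed.

Lemma copy_nzrows p k (M : model p d k) z : regular X M -> selected X z M ->
  List.Forall2 copy_row (nzrows X M) (nzrows X' M).
Proof.
move=> reg sel; rewrite /nzrows; elim: (copy_rows reg sel) => [|r r' s s' rr _ IH] /=.
  by constructor.
by rewrite (copy_row_neq0 rr); case: ifP => _ //; constructor.
Qed.

End same_moments.

(** * The statistic as a function of the moments *)

Section TG_moments.
Context {R : realType} {d : nat}.

Lemma eq_big_Forall2 (T I J : Type) (idx : T) (op : T -> T -> T) (rel : I -> J -> Prop)
    s s' (P : pred I) (P' : pred J) F F' :
  List.Forall2 rel s s' ->
  (forall i j, rel i j -> P' j = P i /\ F' j = F i) ->
  \big[op/idx]_(i <- s | P i) F i = \big[op/idx]_(j <- s' | P' j) F' j.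
Proof.
move=> ss H; elim: ss => [|i j {}s {}s' ij _ IH]; first by rewrite !big_nil.
by rewrite !big_cons; have [-> ->] := H _ _ ij; rewrite IH.
Qed.

(* TG with the rows of Q in a sequence, so that designs with different numbers of
   observations can be compared. *)
Definition TG_of_rows n (s : seq 'rV[R]_n) (y v : 'cV[R]_n) (sigma mu : R) : R :=
  let w r := l2norm v ^- 2 * (r *m v) 0 0 in
  let ratio r := ((r *m y) 0 0 / w r)%:E in
  let vy := (dotp v y)%:E in
  let a := (vy - \big[mine/+oo]_(r <- s | (0 < w r)%R) ratio r)%E in
  let b := (vy - \big[maxe/-oo]_(r <- s | (w r < 0)%R) ratio r)%E in
  let F x := Phi ((x - mu%:E) * ((sigma * l2norm v)^-1)%:E)%E in
  (F b - F vy) / (F b - F a).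

Lemma TGstatE p k n (X : 'M[R]_(n, d)) (M : model p d k) y v sigma mu :
  TGstat X y M v sigma mu = TG_of_rows (nzrows X M) y v sigma mu.
Proof.
rewrite /TGstat /TG /TG_of_rows.
have QE u i : (Qmat X M *m u) i 0 = (tnth (in_tuple (nzrows X M)) i *m u) 0 0.
  have <- : row i (Qmat X M) = tnth (in_tuple (nzrows X M)) i by rewrite rowK.
  by rewrite -row_mul [RHS]mxE.
have wE i : (l2norm v ^- 2 *: (Qmat X M *m v)) i 0 =
    l2norm v ^- 2 * (tnth (in_tuple (nzrows X M)) i *m v) 0 0 by rewrite mxE QE.
have big op idx (P : R -> bool) :
    \big[op/idx]_(i < size (nzrows X M) | P ((l2norm v ^- 2 *: (Qmat X M *m v)) i 0))
      ((Qmat X M *m y) i 0 / (l2norm v ^- 2 *: (Qmat X M *m v)) i 0)%:E =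
    \big[op/idx]_(r <- nzrows X M | P (l2norm v ^- 2 * (r *m v) 0 0))
      ((r *m y) 0 0 / (l2norm v ^- 2 * (r *m v) 0 0))%:E.
  by rewrite [RHS]big_tnth; apply: eq_big => i; rewrite wE// QE.
by rewrite (big _ _ (fun w => w < 0)) (big _ _ (fun w => 0 < w)).
Qed.

(** A copied row with factor [g] has its products with the response and with the contrast both
    multiplied by [g / q > 0]. This keeps the index sets of the minimum and maximum and cancels in
    the ratios. *)
Lemma TGstat_copy p k n n' (X : 'M[R]_(n, d)) (X' : 'M[R]_(n', d)) (q : R)
    (M : model p d k) y y' (A : {set 'I_d}) j sigma mu : 0 < q ->
  X'^T *m X' = q ^- 2 *: (X^T *m X) -> X'^T *m y' = q^-1 *: (X^T *m y) ->
  regular X M -> selected X y M -> gram X (enum A) \in unitmx ->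
  TGstat X' y' M (contrast X' A j) sigma mu = TGstat X y M (contrast X A j) sigma mu.
Proof.
move=> q0 XX Xy reg sel uA.
have cv := copy_contrast q0 XX j uA.
have vyE := dotp_contrast_copy q0 XX Xy j uA.
set v := contrast X A j in cv vyE *; set v' := contrast X' A j in cv vyE *.
have nE : l2norm v' = l2norm v.
  rewrite /l2norm /dotp (copy_tr XX cv cv) mxE -expr2 mulfV ?mul1r//.
  by rewrite expf_neq0// gt_eqF.
have row_mul m (r : 'rV[R]_m) u : (r *m u) 0 0 = dotp r^T u by rewrite /dotp trmxK.
have rE r r' : copy_row X X' r r' -> exists2 c, 0 < c &
    (r' *m y') 0 0 = c * (r *m y) 0 0 /\ (r' *m v') 0 0 = c * (r *m v) 0 0.
  move=> [g g0 rr]; exists (g / q); first by rewrite divr_gt0.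
  rewrite !row_mul (copy_dotp Xy rr); split => //.
  rewrite {1}/dotp (copy_tr XX rr cv) mxE; congr (_ * _).
  by field; rewrite gt_eqF.
have big op idx (P : R -> bool) : (forall c x, 0 < c -> P (c * x) = P x) ->
    \big[op/idx]_(r <- nzrows X' M | P (l2norm v' ^- 2 * (r *m v') 0 0))
      ((r *m y') 0 0 / (l2norm v' ^- 2 * (r *m v') 0 0))%:E =
    \big[op/idx]_(r <- nzrows X M | P (l2norm v ^- 2 * (r *m v) 0 0))
      ((r *m y) 0 0 / (l2norm v ^- 2 * (r *m v) 0 0))%:E.
  move=> Pc; have rows_copy := copy_nzrows q0 XX reg sel.
  apply/esym/(eq_big_Forall2 _ _ rows_copy) => r r' /rE[c c0 [-> ->]].
  rewrite nE mulrCA Pc//; split => //; congr (_%:E).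
  by rewrite -mulf_div divff ?gt_eqF// mul1r.
rewrite !TGstatE /TG_of_rows vyE nE.
rewrite -!nE (big _ _ (fun w => w < 0)) ?(big _ _ (fun w => 0 < w)) ?nE//.
- by move=> c x c0; rewrite pmulr_rgt0.
- by move=> c x c0; rewrite pmulr_rlt0.
Qed.

(** Without observations the Gram matrix is 0, of positive size because [j] belongs to [A].
    Excluding this case makes the normalizations in [Omega] invertible. *)
Lemma gram_unit_gt0 n (X : 'M[R]_(n, d)) (A : {set 'I_d}) j : j \in A ->
  gram X (enum A) \in unitmx -> (0 < n)%N.
Proof.
move=> jA; case: n X => // X uA; exfalso.
have ij : (index j (enum A) < size (enum A))%N by rewrite index_mem mem_enum.
have G0 : gram X (enum A) = 0 by apply/matrixP => a b; rewrite !mxE big_ord0.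
have := mulVmx uA; rewrite {2}G0 mulmx0 => /matrixP/(_ (Ordinal ij) (Ordinal ij)).
by rewrite !mxE eqxx => /eqP; rewrite eq_sym oner_eq0.
Qed.

Lemma Omega_eq n n' (X : 'M[R]_(n, d)) (X' : 'M[R]_(n', d)) y y' :
  (0 < n)%N -> (0 < n')%N -> Omega X y = Omega X' y' ->
  exists2 q : R, 0 < q & X'^T *m X' = q ^- 2 *: (X^T *m X) /\
                         X'^T *m y' = q^-1 *: (X^T *m y).
Proof.
move=> n0 n0' [h1 h2].
have p0 : 0 < Num.sqrt n%:R :> R by rewrite sqrtr_gt0 ltr0n.
have p0' : 0 < Num.sqrt n'%:R :> R by rewrite sqrtr_gt0 ltr0n.
have sq m : (0 < m)%N -> m%:R = Num.sqrt m%:R ^+ 2 :> R by rewrite sqr_sqrtr.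
exists (Num.sqrt n%:R / Num.sqrt n'%:R); first by rewrite divr_gt0.
split.
  apply: (scalerI (a := n'%:R^-1)); first by rewrite invr_eq0 pnatr_eq0 -lt0n.
  rewrite -h1 scalerA; congr (_ *: _).
  move: (sq _ n0) (sq _ n0') p0 p0'.
  move: (Num.sqrt n%:R) (Num.sqrt n'%:R) => a b -> -> a0 b0.
  by field; rewrite !gt_eqF.
apply: (scalerI (a := (Num.sqrt n'%:R)^-1)); first by rewrite invr_eq0 gt_eqF.
rewrite -h2 scalerA; congr (_ *: _).
by field; rewrite !gt_eqF.
Qed.

End TG_moments.

(** A function constant on the fibres of [h] within [D] descends along [h], by choice; [r0] is the
    value at points that [h] does not reach from [D]. *)
Lemma factor_through (I O R : Type) (r0 : R) (D : I -> Prop) (f : I -> R) (h : I -> O) :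
  (forall i i', D i -> D i' -> h i = h i' -> f i = f i') ->
  exists g : O -> R, forall i, D i -> f i = g (h i).
Proof.
move=> H.
have /choice[g gE] : forall o, exists r, forall i, D i -> h i = o -> f i = r.
  move=> o; have [[i [Di <-]]|none] := pselect (exists i, D i /\ h i = o).
    by exists (f i) => i' Di' hi; apply: H.
  by exists r0 => i Di hi; exfalso; apply: none; exists i.
by exists g => i Di; exact: gE.
Qed.

(** * The contrast has unit length *)

Section contrast.
Context {R : realType} {n d : nat}.
Variables (X : 'M[R]_(n, d)) (A : {set 'I_d}) (j : 'I_d).
Hypotheses (jA : j \in A) (uA : gram X (enum A) \in unitmx).

Lemma contrast_unit : dotp (contrast X A j) (contrast X A j) = 1.
Proof.
rewrite /contrast; set e := basis_at _ _; set G := gram _ _.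
have uG : G \in unitmx by exact: uA.
set W := cols X (enum A) *m invmx G *m e; set t := (e^T *m invmx G *m e) 0 0.
have WW : dotp W W = t.
  rewrite /dotp /W !trmx_mul -!mulmxA [(cols X _)^T *m _]mulmxA.
  rewrite -[(cols X _)^T *m cols X _]/G [G *m _]mulmxA mulmxV// mul1mx.
  by rewrite /t -[in RHS](trmxK (e^T *m _ *m _)) [in RHS]mxE !trmx_mul trmxK mulmxA.
(* [t] is the squared length of [W], and [W] is nonzero because its products with the columns in [A]
   form the basis vector [e]. *)
have t0 : 0 < t.
  rewrite lt_neqAle -WW dotp_ge0 andbT eq_sym dotp_eq0; apply/negP => /eqP W0.
  have : (cols X (enum A))^T *m W = e.
    rewrite /W !mulmxA -[(cols X _)^T *m cols X _]/G mulmxV// mul1mx//.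
  rewrite W0 mulmx0 => e0.
  have ij : (index j (enum A) < size (enum A))%N by rewrite index_mem mem_enum.
  move/colP/(_ (Ordinal ij)): e0; rewrite !mxE (tnth_nth j) /= nth_index ?mem_enum//.
  by rewrite eqxx => /eqP; rewrite eq_sym oner_eq0.
rewrite dotpZ /dotp linearZ /= -scalemxAl mxE -/(dotp W W) WW mulrA -expr2 exprVn.
rewrite sqr_sqrtr ?(ltW t0)//.
by rewrite mulVf ?gt_eqF.
Qed.

End contrast.

(** * Expectation of the moments *)

Section expectation_Omega.
Context {dT : measure_display} {T : measurableType dT} {R : realType}.
Variables (P : probability T R) (n d : nat) (X : 'M[R]_(n, d)).
Variables (theta : 'cV[R]_n) (eps : 'I_n -> {RV P >-> R}).
Hypothesis eps0 : forall i, mean_zero (eps i).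

Let expectation_affine (c : R) (a : 'I_n -> R) (r : seq 'I_n) :
  P.-integrable setT (fun w => (c + \sum_(k <- r) a k * eps k w)%:E) /\
  (\int[P]_w (c + \sum_(k <- r) a k * eps k w)%:E = c%:E)%E.
Proof.
have fin : (P setT < +oo)%E by rewrite probability_setT ltry.
elim: r c => [|k r IH] c.
  have -> : (fun w => (c + \sum_(k <- [::]) a k * eps k w)%:E) = cst c%:E.
    by apply/funext => w; rewrite big_nil addr0.
  split; first exact: finite_measure_integrable_cst.
  have := @integral_cst _ _ _ P _ measurableT c%:E.
  by move=> ->; rewrite [X in (_ * X)%E]probability_setT mule1.
have [i1 e1] := IH c; have [i2 e2] := eps0 k.
have -> : (fun w => (c + \sum_(l <- k :: r) a l * eps l w)%:E) =
    (fun w => (c + \sum_(l <- r) a l * eps l w)%:E + (a k)%:E * (eps k w)%:E)%E.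
  apply/funext => w; rewrite big_cons -EFinM -EFinD; congr (_%:E); ring.
have i3 : P.-integrable setT (fun w => (a k)%:E * (eps k w)%:E)%E by exact: integrableZl.
split; first exact: integrableD.
rewrite integralD// e1 integralZl//.
by move: e2; rewrite expectation_def => ->; rewrite mule0 adde0.
Qed.

Lemma EOmega_observation : EOmega P X (observation theta eps) = Omega X theta.
Proof.
rewrite /EOmega; congr (_, _); apply/matrixP => i j; rewrite mxE.
  by rewrite expectation_cst.
rewrite [Z in fine Z](_ : _ = ((Omega X theta).2 i j)%:E)//.
pose b := (Num.sqrt n%:R)^-1 : R.
pose a k := b * X k i.
have [_ h] := expectation_affine ((Omega X theta).2 i j) a (index_enum _).
rewrite -h unlock; apply: eq_integral => w _; congr (_%:E).
rewrite /Omega /= !mxE !mulr_sumr -big_split; apply: eq_bigr => k _ /=.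
by rewrite !mxE (ord1 j) /a /b; ring.
Qed.

End expectation_Omega.

(** * The pivot conditional on the selected model *)

Section conditional_pivot.
Context {R : realType} {d n k : nat} {p : procedure}.
Variables (M : model p d k) (hM : achievable R M).
Variables (X : 'M[R]_(n, d)) (theta v : 'cV[R]_n) (sigma : R).
Hypotheses (s0 : 0 < sigma) (v1 : dotp v v = 1).
Context {dT : measure_display} {T : measurableType dT}.
Variables (P : probability T R) (eps : 'I_n -> {RV P >-> R}).
Hypotheses (eps_iid : iid eps) (eps_normal : forall i, gaussian sigma (eps i)).

(** Achievability of [M] turns the selection event into the polyhedron of [Qmat X M]. The identity
    for the law of the sample is pulled back to [P] and divided by the positive probability of
    selection. *)
Lemma TGstat_pivot t :
  (0 < P [set w | selected X (observation theta eps w) M])%E -> 0 <= t <= 1 ->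
  condprob P
    [set w | TGstat X (observation theta eps w) M v sigma (dotp v theta) <= t]
    [set w | selected X (observation theta eps w) M] = t.
Proof.
move=> sel0 t01.
pose obs (y : n.-tuple R) := (\col_i (theta i 0 + tnth y i)) : 'cV[R]_n.
pose S := [set y | forall i, 0 <= (Qmat X M *m obs y) i 0].
have obsE w : observation theta eps w = obs (sample eps w).
  by apply/colP => i; rewrite !mxE tnth_mktuple.
have selE : [set w | selected X (observation theta eps w) M] = sample eps @^-1` S.
  by apply/seteqP; split => w /=; rewrite selectedP// obsE.
have main := TG_pivot (Qmat X M) theta v1 s0 (sample_lawE eps_iid eps_normal) t01.
have mS : measurable (sample eps @^-1` S).
  rewrite -[X in measurable X]setTI; apply: measurable_sample => //.
  exact: measurable_polyhedron.
rewrite /condprob; rewrite selE in sel0 *.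
have -> : P ([set w | TGstat X (observation theta eps w) M v sigma (dotp v theta) <= t]
      `&` sample eps @^-1` S) = (t%:E * P (sample eps @^-1` S))%E.
  apply: etrans main; congr (P _).
  by apply/seteqP; split => w /=; rewrite obsE => -[].
have finS : P (sample eps @^-1` S) \is a fin_num by exact: fin_num_measure.
rewrite fineM// mulfK// gt_eqF// fine_gt0// sel0 /=.
by rewrite -ge0_fin_numE.
Qed.

End conditional_pivot.

Theorem lemma5 (R : realType) (p : procedure) (d k : nat) (hk : (0 < k)%N)
    (M : model p d k) (hM : achievable R M) (mu sigma : R) (hsigma : 0 < sigma)
    (A : {set 'I_d}) (j : 'I_d) (hj : j \in A) :
  exists g : 'M[R]_d * 'cV[R]_d -> R,
    (forall (n : nat) (X : 'M[R]_(n, d)) (theta : 'cV[R]_n)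
            (dT : measure_display) (T : measurableType dT)
            (P : probability T R) (eps : 'I_n -> {RV P >-> R}),
        gram X (enum A) \in unitmx ->
        iid eps -> (forall i, mean_zero (eps i)) ->
        dotp (contrast X A j) theta = g (EOmega P X (observation theta eps)))
    /\
    exists psi : 'M[R]_d * 'cV[R]_d -> R,
      (forall (n : nat) (X : 'M[R]_(n, d)) (y : 'cV[R]_n),
          regular X M -> gram X (enum A) \in unitmx -> selected X y M ->
          TGstat X y M (contrast X A j) sigma mu = psi (Omega X y))
      /\
      (forall (n : nat) (X : 'M[R]_(n, d)) (theta : 'cV[R]_n)
              (dT : measure_display) (T : measurableType dT)
              (P : probability T R) (eps : 'I_n -> {RV P >-> R}),
          let v := contrast X A j in
          let Y := observation theta eps in
          let selM := [set w | selected X (Y w) M] in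
          regular X M -> gram X (enum A) \in unitmx ->
          iid eps -> (forall i, gaussian sigma (eps i)) ->
          (0 < P selM)%E ->
          (dotp v theta = mu ->
             forall t : R, 0 <= t <= 1 ->
               condprob P [set w | TGstat X (Y w) M v sigma mu <= t] selM = t)
          /\
          (g (EOmega P X Y) = mu ->
             forall t : R, 0 <= t <= 1 ->
               condprob P [set w | psi (Omega X (Y w)) <= t] selM = t)).

Proof.
(* Designs of all sample sizes are gathered in one type, so that a single [g] and a single [psi]
   serve every [n]. *)
pose design := {n : nat & ('M[R]_(n, d) * 'cV[R]_n)%type}.
pose mk n X y : design := existT _ n (X, y).
pose full_rank (i : design) := gram (projT2 i).1 (enum A) \in unitmx.
pose Om (i : design) := Omega (projT2 i).1 (projT2 i).2.
have [g gE] : exists g, forall i, full_rank i ->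
    dotp (contrast (projT2 i).1 A j) (projT2 i).2 = g (Om i).
  apply: (factor_through 0) => -[n [X y]] [n' [X' y']]; rewrite /full_rank /Om /= => u u' O.
  have [q q0 [XX Xy]] := Omega_eq (gram_unit_gt0 hj u) (gram_unit_gt0 hj u') O.
  by rewrite (dotp_contrast_copy q0 XX Xy j u).
have gEO n (X : 'M[R]_(n, d)) theta dT (T : measurableType dT) (P : probability T R)
    (eps : 'I_n -> {RV P >-> R}) : gram X (enum A) \in unitmx ->
    (forall i, mean_zero (eps i)) ->
    dotp (contrast X A j) theta = g (EOmega P X (observation theta eps)).
  (* The mean of [Omega] is its value at the response [theta], where [g] is evaluated. *)
  by move=> u e0; rewrite EOmega_observation//; exact: (gE (mk n X theta)).
exists g; split; first by move=> n X theta dT T P eps u _; exact: gEO.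
have [psi psiE] : exists psi, forall i, [/\ regular (projT2 i).1 M, full_rank i &
      selected (projT2 i).1 (projT2 i).2 M] ->
    TGstat (projT2 i).1 (projT2 i).2 M (contrast (projT2 i).1 A j) sigma mu = psi (Om i).
  apply: (factor_through 0) => -[n [X y]] [n' [X' y']]; rewrite /full_rank /Om /=.
  move=> [reg u sel] [_ u' _] O.
  have [q q0 [XX Xy]] := Omega_eq (gram_unit_gt0 hj u) (gram_unit_gt0 hj u') O.
  by rewrite (TGstat_copy j sigma mu q0 XX Xy reg sel u).
exists psi; split; first by move=> n X y reg u sel; exact: (psiE (mk n X y)).
move=> n X theta dT T P eps v Y selM reg u eps_iid eps_normal sel0.
have pivot : dotp v theta = mu -> forall t, 0 <= t <= 1 ->
    condprob P [set w | TGstat X (Y w) M v sigma mu <= t] selM = t.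
  by move=> <- t; apply: TGstat_pivot => //; exact: contrast_unit.
split=> // vmu t t01.
have {}vmu : dotp v theta = mu.
  by rewrite -vmu; apply: gEO => // i; exact: gaussian_mean_zero (eps_normal i).
(* On the selection event [psi] equals the statistic, so both conditional probabilities concern the
   same event. *)
rewrite -[RHS](pivot vmu t t01) /condprob; congr (fine (P _) / _).
apply/seteqP; split => w /= [h sel]; split => //.
  by rewrite (psiE (mk n X (Y w))).
by have := psiE (mk n X (Y w)) (And3 reg u sel) => <-.
Qed.
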